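(* Let $0<p<\infty$ and let $\varphi:\mathbb{R}^n\times[0,\infty)\to[0,\infty)$ be such that $(x,t)\mapsto\varphi(x,t^{1/p})$ is a generalized $\varphi$-function on $\mathbb{R}^n$. Let $v,w$ be weight functions on $\mathbb{R}^n$. For measurable $f>0$ let $$Gf(x)=\exp\left(\frac{1}{|B(0,|x|)|}\int_{B(0,|x|)}\ln f(y)\,dy\right).$$ For $s>1$ define $$D(s)=\sup_{t>0}|B(0,t)|^{\frac{s-1}{p}}\left\|\frac{\chi_{\{|z|>t\}}(\cdot)}{|B(0,|\cdot|)|^{\frac{s}{p}}}\exp\left(\frac{1}{|B(0,|\cdot|)|}\int_{B(0,|\cdot|)}\ln\frac{1}{v(y)}\,dy\right)\right\|_{L_{\varphi,w}}.$$ Then, for every $s>1$, there is a finite constant $C>0$ such that $$\|Gf\|_{L_{\varphi,w}}\le C\,\|f\|_{L_{p,v}}\quad\text{for every } f>0$$ if and only if $D(s)<\infty$. Moreover, if $C$ is the best possible constant in this inequality, then $$\sup_{s>1}\frac{e^{s/p}}{\left(e^{s}+\frac{1}{s-1}\right)^{1/p}}\,D(s)\le C\le 2^{1/p}\inf_{s>1}e^{\frac{s-1}{p}}D(s).$$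
   Context: $B(0,r)$ is the open ball of radius $r$ centred at $0$ in $\mathbb{R}^n$ and $|E|$ denotes Lebesgue measure. A weight function is a positive, Lebesgue measurable, a.e. finite function on $\mathbb{R}^n$. $\|f\|_{L_{p,v}}=\left(\int_{\mathbb{R}^n}|f(y)v(y)|^p\,dy\right)^{1/p}$. A function $\psi:\Omega\times[0,\infty)\to[0,\infty)$, $\Omega\subset\mathbb{R}^n$ measurable, is a generalized $\varphi$-function on $\Omega$ if for every $x\in\Omega$ the function $\psi(x,\cdot)$ is convex with $\psi(x,0)=0$ and $\lim_{t\to+0}\psi(x,t)=0$, and for every $t\ge0$ the function $x\mapsto\psi(x,t)$ is measurable. For measurable $f$ on $\mathbb{R}^n$, $\rho_\varphi(f)=\int_{\mathbb{R}^n}\varphi(y,|f(y)|)\,dy$, $\|f\|_{L_\varphi}=\inf\{\lambda>0:\rho_\varphi(f/\lambda)\le1\}$ (equal to $\infty$ if no such $\lambda$ exists), and $\|f\|_{L_{\varphi,w}}=\|fw\|_{L_\varphi}$ (weighted Musielak–Orlicz space). The averages of $\ln f$ and $\ln(1/v)$ over balls centred at the origin are understood to be well defined (possibly $\pm\infty$, with $\exp(-\infty)=0$, $\exp(+\infty)=+\infty$); the inequality for $G$ concerns those $f>0$ for which $Gf$ is so defined. *)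

(* Defs.v *)
From HB Require Import structures.
From mathcomp Require Import all_boot all_order all_algebra.
From mathcomp Require Import all_classical all_reals all_analysis.
From mathcomp Require Import measurable_realfun.

Set Implicit Arguments.
Unset Strict Implicit.
Unset Printing Implicit Defensive.
Import Order.TTheory GRing.Theory Num.Theory.
Import numFieldNormedType.Exports.

Local Open Scope classical_set_scope.
Local Open Scope ring_scope.

(* Points of R^n are n-tuples, because n.-tuple carries the product sigma-algebra
   (the Borel sets of R^n). *)
Notation borelRn R n := (n.-tuple (measurableTypeR R)).

Section cons_measure.
Context {R : realType} {n : nat}.
Variable m : {sigma_finite_measure set (borelRn R n) -> \bar R}.

Definition cons_pair (x : measurableTypeR R * borelRn R n) : borelRn R n.+1 :=
  [tuple of x.1 :: x.2].

Let measurable_cons_pair : measurable_fun [set: _] cons_pair.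
Proof. exact: measurable_cons. Qed.

Definition cons_measure : set (borelRn R n.+1) -> \bar R :=
  pushforward ((@lebesgue_measure R) \x m)%E cons_pair.

Let cons_measure0 : cons_measure set0 = 0%E.
Proof. by rewrite /cons_measure /pushforward preimage_set0 measure0. Qed.

Let cons_measure_ge0 A : (0 <= cons_measure A)%E.
Proof. by rewrite /cons_measure /pushforward measure_ge0. Qed.

Let cons_measure_sigma_additive : semi_sigma_additive cons_measure.
Proof.
move=> F mF tF mUF; rewrite /cons_measure /pushforward preimage_bigcup.
apply: measure_semi_sigma_additive.
- by move=> i; rewrite -[X in measurable X]setTI; exact: measurable_cons_pair.
- apply/trivIsetP => /= i j _ _ ij; rewrite -preimage_setI.
  by move/trivIsetP : tF => /(_ _ _ _ _ ij) ->//; rewrite preimage_set0.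
- by rewrite -preimage_bigcup -[X in measurable X]setTI; exact: measurable_cons_pair.
Qed.

HB.instance Definition _ := isMeasure.Build _ _ _ cons_measure
  cons_measure0 cons_measure_ge0 cons_measure_sigma_additive.

Let cons_measure_sigma_finite : sigma_finite [set: _] cons_measure.
Proof.
have /sigma_finiteP[F [TF ndF Foo]] := sigma_finiteT (@lebesgue_measure R).
have /sigma_finiteP[G [TG ndG Goo]] := sigma_finiteT m.
pose g (t : borelRn R n.+1) : measurableTypeR R * borelRn R n :=
  (thead t, [tuple of behead t]).
have mg : measurable_fun [set: _] g.
  apply/measurable_fun_pair; first exact: measurable_tnth.
  exact: measurable_behead.
have gK : g \o cons_pair = id.
  apply/funext => -[x t]; rewrite /g /cons_pair /=.
  by congr pair; apply/val_inj.
exists (fun i => g @^-1` (F i `*` G i)).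
  rewrite -preimage_bigcup -(preimage_setT g); congr (_ @^-1` _).
  apply/seteqP; split => // -[x y] _.
  have [i _ Fix] : (\bigcup_i F i) x by rewrite -TF.
  have [j _ Gjy] : (\bigcup_i G i) y by rewrite -TG.
  exists (maxn i j) => //; split => /=.
    by move: Fix; exact/subsetPset/ndF/leq_maxl.
  by move: Gjy; exact/subsetPset/ndG/leq_maxr.
move=> i; have [mF Fioo] := Foo i; have [mG Gioo] := Goo i; split.
  by rewrite -[X in measurable X]setTI; apply: mg => //; exact: measurableX.
rewrite /cons_measure /pushforward -comp_preimage gK preimage_id.
by rewrite product_measure1E// lte_mul_pinfty// ge0_fin_numE.
Qed.

HB.instance Definition _ := Measure_isSigmaFinite.Build _ _ _ cons_measure
  cons_measure_sigma_finite.

End cons_measure.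

(* n-fold product of the one-dimensional Lebesgue measure, on Borel sets. *)
Fixpoint borel_lebesgue (R : realType) (n : nat) :
    {sigma_finite_measure set (borelRn R n) -> \bar R} :=
  match n with
  | 0 => \d_([tuple] : borelRn R 0)
  | n.+1 => cons_measure (borel_lebesgue R n)
  end.

Section lebesgue_Rn.
Variables (R : realType) (n : nat).

(* R^n with its Lebesgue sigma-algebra: the sets that are measurable, in
   Caratheodory's sense, for the outer measure induced by borel_lebesgue. *)
Definition Rn : Type :=
  caratheodory_type ((borel_lebesgue R n)^*)%mu.
HB.instance Definition _ := Measurable.on Rn.

Definition lebesgue : set Rn -> \bar R :=
  @completed_measure_extension _ _ _ (borel_lebesgue R n).
HB.instance Definition _ := Measure.on lebesgue.

Let lebesgue_sigma_finite : sigma_finite [set: _] lebesgue.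
Proof. exact/completed_measure_extension_sigma_finite/sigma_finiteT. Qed.

HB.instance Definition _ := Measure_isSigmaFinite.Build _ _ _ lebesgue
  lebesgue_sigma_finite.

Definition enorm (x : Rn) : R := Num.sqrt (\sum_(i < n) tnth x i ^+ 2).

Definition eball (r : R) : set Rn := [set x | enorm x < r].

End lebesgue_Rn.
Arguments lebesgue {R n}.
Arguments enorm {R n}.
Arguments eball {R} n.

Section spaces.
Context {R : realType} {n : nat}.
Local Notation X := (Rn R n).
Local Notation mu := (@lebesgue R n).
Implicit Types (phi psi : X -> R -> R) (f h v w : X -> \bar R) (p s : R).

(* Only the values psi x t with 0 <= t matter. *)
Definition generalized_phi_function psi :=
  [/\ forall x t, 0 <= t -> 0 <= psi x t,
      forall x, @convex_function R R^o `[0, +oo[ (psi x),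
      forall x, psi x 0 = 0,
      forall x, psi x t @[t --> 0^'+] --> (0 : R) &
      forall t, 0 <= t -> measurable_fun [set: X] (psi ^~ t)].

Local Open Scope ereal_scope.

Definition weight w :=
  [/\ measurable_fun [set: X] w, forall x, 0 < w x &
      {ae mu, forall x, w x < +oo}].

(* phi x is extended to t = +oo by its limit at infinity, which for a
   nondecreasing function is its supremum; this is needed because geometric
   means take values in [0, +oo]. *)
Definition phi_ext phi (x : X) (t : \bar R) : \bar R :=
  match t with
  | r%:E => (phi x r)%:E
  | _ => ereal_sup [set (phi x r)%:E | r in [set r | (0 <= r)%R]]
  end.

Definition modular phi f : \bar R := \int[mu]_y phi_ext phi y `|f y|.

Definition musielak_norm phi f : \bar R :=
  ereal_inf [set l%:E | l in
    [set l : R | (0 < l)%R /\ modular phi (fun x => f x * l^-1%:E) <= 1]].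

Definition weighted_musielak_norm phi w f : \bar R :=
  musielak_norm phi (fun x => f x * w x).

Definition weighted_Lnorm p v f : \bar R :=
  'N[mu]_p%:E[f \* v].

(* At x = 0 the ball is empty and the value is 0 (+oo * 0); for n > 0 this
   concerns a null set only. *)
Definition average h (x : X) : \bar R :=
  (mu (eball n (enorm x)))^-1 * \int[mu]_(y in eball n (enorm x)) h y.

(* Excludes the case oo - oo, to which \int would assign -oo. *)
Definition averages_defined h :=
  forall r : R, (0 < r)%R ->
    \int[mu]_(y in eball n r) h^\+ y < +oo \/
    \int[mu]_(y in eball n r) h^\- y < +oo.

Definition geomean f (x : X) : \bar R := expeR (average (fun y => lne (f y)) x).

(* The functions f, like the weights, take values in ]0, +oo]. *)
Definition geomean_inequality phi p v w (C : R) :=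
  forall f, measurable_fun [set: X] f -> (forall x, 0 < f x) ->
    averages_defined (fun y => lne (f y)) ->
    weighted_musielak_norm phi w (geomean f) <= C%:E * weighted_Lnorm p v f.

(* +oo when the inequality holds with no finite constant *)
Definition best_constant phi p v w : \bar R :=
  ereal_inf [set C%:E | C in
    [set C : R | (0 < C)%R /\ geomean_inequality phi p v w C]].

Definition D phi p v w s : \bar R :=
  ereal_sup [set
    mu (eball n t) `^ ((s - 1) / p)%R *
    weighted_musielak_norm phi w (fun x =>
      (\1_[set z : X | (t < enorm z)%R] x)%:E / mu (eball n (enorm x)) `^ (s / p)%R
      * geomean (fun y => (v y)^-1) x)
    | t in [set t : R | (0 < t)%R]].

End spaces.

(* Main.v *)
(* Put psi x t = phi x (t^(1/p)), m(y) = |B(0,|y|)| and h = (f v)^p.  Then psi x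
   is convex, and the image of Lebesgue measure under m is Lebesgue measure on
   [0, +oo[.

   Upper bound: the average of ln m over B(0,|x|) is at least ln m(x) - 1, so
   Jensen's inequality for ln, applied to m^(s-1) h, gives
     (Gf(x))^p <= e^(s-1) m(x)^(-s) (G(1/v)(x))^p \int_{B(0,|x|)} m^(s-1) h.
   Jensen's inequality for psi x with respect to the measure h dy, followed by
   Tonelli's theorem, reduces the modular of Gf w to the modulars of the functions
   whose norms define D(s).  The result is C <= e^((s-1)/p) D(s), without the
   factor 2^(1/p).

   Lower bound: with T = |B(0,t)|, let g = 1/T where m <= T, and
   g = e^(-s) T^(s-1) m^(-s) elsewhere.  Then Gg = T^(s-1) m^(-s) outside B(0,t),
   while \int g <= 1 + e^(-s)/(s-1); the inequality is tested on g^(1/p)/v. *)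

Require Import Defs.
From HB Require Import structures.
From mathcomp Require Import all_boot all_order all_algebra.
From mathcomp Require Import all_classical all_reals all_analysis.
From mathcomp Require Import measurable_realfun.
From mathcomp Require Import ring lra.
Import Order.TTheory GRing.Theory Num.Theory.
Import numFieldNormedType.Exports.
Local Open Scope classical_set_scope.
Local Open Scope ring_scope.
Set Implicit Arguments.
Unset Strict Implicit.
Unset Printing Implicit Defensive.

(** * Borel measure on R^n: spheres and cubes *)

(** The weight m^(s-1) is what ties the pointwise bound to D(s): for fixed y, the kernel 1_{|y|<|x|}
    m(y)^(s-1) m(x)^(-s) (G(1/v)(x) w(x))^p is, up to a constant, the p-th power of the weighted
    function whose norm enters D(s) at the radius |y|. So (Gf w)^p is dominated by an average,
    against h dy / \int h, of functions of modular at most 1, and such an average keeps modular at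
    most 1. Nothing is lost there, hence no power of 2. The factor e^(s-1) comes from \int_0^V (ln V
    - ln u) du = V. In g the factor e^(-s) compensates the same loss, so that its logarithm averages
    exactly. Two obstacles shape the proof. Geometric means may be +oo and logarithms need not be
    integrable, so Jensen's inequality and additivity of the integral are needed for extended
    values; tangent lines provide the former. And phi is measurable in x only for each fixed t, so
    the measurability of x -> psi x (u x) has to come from convexity. *)

Definition sumsq {R : realType} {n} (x : borelRn R n) : R :=
  \sum_(i < n) tnth x i ^+ 2.

Section borel_lebesgue_sets.
Context {R : realType}.

Lemma measurable_sumsq n : measurable_fun [set: borelRn R n] (@sumsq R n).
Proof.
apply: measurable_sum => i.
by apply: (@measurable_funX _ _ _ _ (fun x => tnth x i)); exact: measurable_tnth.
Qed.

Lemma measurable_cube n (a : R) :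
  measurable [set x : borelRn R n | forall i, `|tnth x i| < a].
Proof.
rewrite [X in measurable X](_ : _ =
    \bigcap_(i in [set: 'I_n]) [set x : borelRn R n | `|tnth x i| < a]).
  apply: fin_bigcap_measurable => [|i _]; first exact: finite_finset.
  rewrite (_ : [set _ | _] = (fun x : borelRn R n => tnth x i) @^-1` `]-a, a[%classic).
    by rewrite -[X in measurable X]setTI; exact: measurable_tnth.
  by apply/seteqP; split=> x /=; rewrite in_itv/= ltr_norml.
by apply/seteqP; split=> x h i /=; [move=> _|]; exact: h.
Qed.

Lemma cons_measureE n (A : set (borelRn R n.+1)) :
  borel_lebesgue R n.+1 A =
  ((@lebesgue_measure R) \x borel_lebesgue R n)%E (@cons_pair R n @^-1` A).
Proof. by []. Qed.

(** With all coordinates but the first fixed, at most two points of the sphere remain. The first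
    variable must therefore be integrated innermost, hence the change to [\x^]. *)
Lemma borel_lebesgue_sphere n (rho : R) :
  borel_lebesgue R n.+1 [set x | sumsq x = rho] = 0%E.
Proof.
have mS : measurable [set x : borelRn R n.+1 | sumsq x = rho].
  rewrite -[X in measurable X]setTI -[X in _ `&` X]/(@sumsq R n.+1 @^-1` [set rho]).
  exact: measurable_sumsq.
have mcp : measurable_fun [set: _] (@cons_pair R n) by exact: measurable_cons.
have mS' : measurable (@cons_pair R n @^-1` [set x | sumsq x = rho]).
  by rewrite -[X in measurable X]setTI; exact: mcp.
rewrite cons_measureE.
rewrite (@product_measure_unique _ _ _ _ _ _ _
  ((@lebesgue_measure R) \x^ borel_lebesgue R n)%E)//; last first.
  by move=> A B mA mB; exact: product_measure2E.
apply: integral0_eq => y _ /=.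
apply: countable_lebesgue_measure0; apply: finite_set_countable.
pose a := Num.sqrt (rho - sumsq y).
apply: (@sub_finite_set _ _ [set a; - a]); last exact: finite_set2.
move=> x; rewrite /ysection/= inE/= /sumsq big_ord_recl/=.
rewrite [tnth _ ord0](_ : _ = x)//.
under eq_bigr do rewrite tnthS.
rewrite -/(sumsq y) => xE.
have : `|x| = a by rewrite /a -xE addrK sqrtr_sqr.
by rewrite /=; case: (ger0P x) => _ <-; [left|right; rewrite opprK].
Qed.

Lemma borel_lebesgue_cube n (a : R) : 0 <= a ->
  borel_lebesgue R n [set x | forall i, `|tnth x i| < a] = ((a *+ 2) ^+ n)%:E.
Proof.
move=> a0; elim: n => [|n ih].
  rewrite /= diracE expr0 mem_set//.
  by move=> [].
rewrite cons_measureE (_ : _ @^-1` _ = `]-a, a[%classic `*`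
    [set x : borelRn R n | forall i, `|tnth x i| < a]).
  rewrite product_measure1E//; last exact: measurable_cube.
  have leba : lebesgue_measure (`]-a, a[%classic : set R) = (a *+ 2)%:E.
    rewrite lebesgue_measure_itv/= lte_fin; case: ifPn => [_|].
      by rewrite -EFinB opprK.
    by rewrite -leNgt => aa; congr EFin; lra.
  by rewrite ih exprS EFinM; congr (_ * _)%E.
apply/seteqP; split => -[x y]/=.
  move=> h; split.
    by rewrite in_itv/= -ltr_norml; have := h ord0.
  move=> i; by have := h (lift ord0 i); rewrite tnthS.
move=> [+ h] i; rewrite in_itv/= -ltr_norml => h0.
case: (unliftP ord0 i) => [j ->|->]//.
by rewrite tnthS.
Qed.

End borel_lebesgue_sets.

(** * Volume of Euclidean balls *)

Section Rn_balls.
Context {R : realType} {n : nat}.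
Local Notation X := (Rn R n).
Local Notation mu := (@lebesgue R n).

Lemma measurable_Rn_borel (A : set (borelRn R n)) :
  measurable A -> measurable (A : set X).
Proof. exact: caratheodory_measurable_mu_ext. Qed.

Lemma lebesgue_borel (A : set (borelRn R n)) :
  measurable A -> mu A = borel_lebesgue R n A.
Proof. exact: measurable_mu_extE. Qed.

Lemma enormE (x : X) : enorm x = Num.sqrt (sumsq (x : borelRn R n)).
Proof. by []. Qed.

Lemma sumsq_ge0 (x : borelRn R n) : 0 <= sumsq x.
Proof. by apply: sumr_ge0 => i _; exact: sqr_ge0. Qed.

Lemma enorm_ge0 (x : X) : 0 <= enorm x.
Proof. exact: sqrtr_ge0. Qed.

Lemma enorm_sqr (x : X) : enorm x ^+ 2 = sumsq (x : borelRn R n).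
Proof. by rewrite enormE sqr_sqrtr// sumsq_ge0. Qed.

Lemma measurable_enorm : measurable_fun [set: X] (@enorm R n).
Proof.
move=> _ Y mY; rewrite setTI; apply: measurable_Rn_borel.
rewrite -[X in measurable X]setTI.
have msqrt := continuous_measurable_fun (@sqrt_continuous R).
exact: (measurableT_comp msqrt (@measurable_sumsq R n)).
Qed.

Lemma measurable_eball r : measurable (eball n r : set X).
Proof.
rewrite (_ : eball n r = @enorm R n @^-1` `]-oo, r[%classic).
  by rewrite -[X in measurable X]setTI; exact: measurable_enorm.
by apply/seteqP; split=> x; rewrite /= in_itv.
Qed.

Lemma eball_le0 r : r <= 0 -> eball n r = set0 :> set X.
Proof.
move=> r0; apply/seteqP; split=> // x; rewrite /eball/= => xr.
by have := enorm_ge0 x; rewrite leNgt (lt_le_trans xr).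
Qed.

Lemma subset_eball r s : r <= s -> eball n r `<=` (eball n s : set X).
Proof. by move=> rs x; rewrite /eball/= => /lt_le_trans; apply. Qed.

Lemma le_lebesgue_eball r s : r <= s -> (mu (eball n r) <= mu (eball n s))%E.
Proof.
move=> rs; apply: le_measure; rewrite ?inE; try exact: measurable_eball.
exact: subset_eball.
Qed.

Lemma lebesgue_eball_lty r : (mu (eball n r) < +oo)%E.
Proof.
have [r0|r0] := leP r 0; first by rewrite eball_le0// measure0 ltry.
apply: (@le_lt_trans _ _ (mu [set x : borelRn R n | forall i, `|tnth x i| < r])).
  apply: le_measure; rewrite ?inE.
  - exact: measurable_eball.
  - by apply: measurable_Rn_borel; exact: measurable_cube.
  - move=> x xr i; rewrite -(ltr_pXn2r (n := 2))// ?nnegrE//; last exact: ltW.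
    apply: (@le_lt_trans _ _ (enorm x ^+ 2)).
      rewrite enorm_sqr /sumsq (bigD1 i)//= real_normK ?num_real// lerDl.
      by apply: sumr_ge0 => j _; exact: sqr_ge0.
    by rewrite ltr_pXn2r// ?nnegrE ?enorm_ge0// ltW.
rewrite lebesgue_borel; last exact: measurable_cube.
by rewrite borel_lebesgue_cube ?ltry// ltW.
Qed.

(** The cube of half-side r / (n + 1) lies in the ball because n (r / (n + 1))^2 < r^2; n + 1 avoids
    a square root and a division by 0 when n = 0. *)
Lemma lebesgue_eball_ge r : 0 < r ->
  (((r / n.+1%:R *+ 2) ^+ n)%:E <= mu (eball n r))%E.
Proof.
move=> r0; have rn0 : 0 < r / n.+1%:R by rewrite divr_gt0.
rewrite -borel_lebesgue_cube; last exact: ltW.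
rewrite -lebesgue_borel; last exact: measurable_cube.
apply: le_measure; rewrite ?inE.
- by apply: measurable_Rn_borel; exact: measurable_cube.
- exact: measurable_eball.
- move=> x xr; rewrite /eball/= -(ltr_pXn2r (n := 2))// ?nnegrE ?enorm_ge0//; last exact: ltW.
  rewrite enorm_sqr.
  apply: (@le_lt_trans _ _ (\sum_(i < n) (r / n.+1%:R) ^+ 2)).
    apply: ler_sum => i _; rewrite -[leLHS]real_normK ?num_real//.
    by rewrite ler_pXn2r// ?nnegrE ?ltW//; exact: xr.
  rewrite sumr_const card_ord -[ltLHS]mulr_natl expr_div_n.
  rewrite mulrCA.
  rewrite gtr_pMr ?exprn_gt0// ltr_pdivrMr ?exprn_gt0// mul1r.
  by rewrite expr2 -natrM ltr_nat mulnS ltn_addr.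
Qed.

Lemma lebesgue_eball_gt0 r : 0 < r -> (0 < mu (eball n r))%E.
Proof.
move=> r0; apply: lt_le_trans (lebesgue_eball_ge r0).
by rewrite lte_fin exprn_gt0// mulrn_wgt0// divr_gt0.
Qed.

End Rn_balls.

Section ball_volume.
Context {R : realType} {n : nat}.
Hypothesis n_gt0 : (0 < n)%N.
Local Notation X := (Rn R n).
Local Notation mu := (@lebesgue R n).

(** For n = 0 the sphere of radius 0 is the whole space, of mass 1; hence [n_gt0]. *)
Lemma lebesgue_sphere (r : R) : mu [set x : X | enorm x = r] = 0%E.
Proof.
have mS : measurable [set x : borelRn R n | sumsq x = r ^+ 2].
  rewrite -[X in measurable X]setTI -[X in _ `&` X]/(@sumsq R n @^-1` [set r ^+ 2]).
  exact: measurable_sumsq.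
apply: (@subset_measure0 _ _ _ mu _ [set x : X | sumsq x = r ^+ 2]).
- rewrite -[X in measurable X]setTI -[X in _ `&` X]/(@enorm R n @^-1` [set r]).
  exact: measurable_enorm.
- exact: measurable_Rn_borel.
- by move=> x /= <-; rewrite enorm_sqr.
- transitivity (borel_lebesgue R n [set x | sumsq x = r ^+ 2]).
    exact: lebesgue_borel.
  by clear mS; move: n_gt0; case: n => // n' _; exact: borel_lebesgue_sphere.
Qed.

(** Left continuity of the volume: the ball is the increasing union of the balls of radius r -
    1/(k+1). *)
Lemma lebesgue_eball_le (r u : R) : 0 <= u ->
  (forall s, s < r -> (mu (eball n s) <= u%:E)%E) -> (mu (eball n r) <= u%:E)%E.
Proof.
move=> u0 h.
have E : \bigcup_k eball n (r - k.+1%:R^-1) = eball n r :> set X.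
  apply/seteqP; split=> [x [k _]|x xr].
    by rewrite /eball/= => /lt_le_trans; apply; rewrite gerBl.
  have xr' : 0 < r - enorm x by rewrite subr_gt0.
  exists (Num.truncn (r - enorm x)^-1) => //; rewrite /eball/=.
  rewrite ltrBrDl -ltrBrDr invf_plt ?posrE//.
  exact: truncnS_gt.
have : (mu \o (fun k => eball n (r - k.+1%:R^-1))) x @[x --> \oo] -->
    mu (\bigcup_k eball n (r - k.+1%:R^-1)).
  apply: nondecreasing_cvg_mu => //.
  - by move=> i; exact: measurable_eball.
  - by rewrite E; exact: measurable_eball.
  - move=> i j ij; apply/subsetPset; apply: subset_eball.
    by rewrite lerB// lef_pV2 ?posrE// ler_nat.
rewrite E => /cvg_lim <-//; apply: lime_le.
  apply: ereal_nondecreasing_is_cvgn => i j ij; apply: le_lebesgue_eball.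
  by rewrite lerB// lef_pV2 ?posrE// ler_nat.
by apply: nearW => k; apply: h; rewrite ltrBlDr ltrDl.
Qed.

(** Right continuity of the volume. The balls of radius r + 1/(k+1) decrease to the closed ball,
    which has the measure of the open one because spheres are null. *)
Lemma lebesgue_eball_ge_lim (r u : R) :
  (forall s, r < s -> (u%:E <= mu (eball n s))%E) -> (u%:E <= mu (eball n r))%E.
Proof.
move=> h.
have mB : measurable [set x : X | enorm x <= r].
  rewrite (_ : [set _ | _] = @enorm R n @^-1` `]-oo, r]%classic).
    by rewrite -[X in measurable X]setTI; exact: measurable_enorm.
  by apply/seteqP; split=> x; rewrite /= in_itv.
have E : \bigcap_k eball n (r + k.+1%:R^-1) = [set x : X | enorm x <= r].
  apply/seteqP; split=> [x xr|x xr k _]; last first.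
    by rewrite /eball/= (le_lt_trans xr)// ltrDl.
  rewrite /= leNgt; apply/negP => rx.
  have xr' : 0 < enorm x - r by rewrite subr_gt0.
  have := xr (Num.truncn (enorm x - r)^-1) I.
  rewrite /eball/= ltNge => /negP; apply.
  rewrite -lerBrDl invf_ple ?posrE//.
  by rewrite ltW// truncnS_gt.
have -> : mu (eball n r) = mu [set x : X | enorm x <= r].
  rewrite (_ : [set x | _] = eball n r `|` [set x : X | enorm x = r]).
    rewrite measureU0//; first exact: measurable_eball; last exact: lebesgue_sphere.
    rewrite -[X in measurable X]setTI -[X in _ `&` X]/(@enorm R n @^-1` [set r]).
    exact: measurable_enorm.
  apply/seteqP; split=> x; rewrite /eball/= le_eqVlt.
    by case/orP => [/eqP|]; [right|left].
  by case=> [->|->]; rewrite ?orbT// eqxx.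
have : (mu \o (fun k => eball n (r + k.+1%:R^-1))) x @[x --> \oo] -->
    mu (\bigcap_k eball n (r + k.+1%:R^-1)).
  apply: nonincreasing_cvg_mu => //.
  - exact: lebesgue_eball_lty.
  - by move=> i; exact: measurable_eball.
  - by rewrite E.
  - move=> i j ij; apply/subsetPset; apply: subset_eball.
    by rewrite lerD2l lef_pV2 ?posrE// ler_nat.
rewrite E => /cvg_lim <-//; apply: lime_ge.
  apply: ereal_nonincreasing_is_cvgn => i j ij; apply: le_lebesgue_eball.
  by rewrite lerD2l lef_pV2 ?posrE// ler_nat.
by apply: nearW => k; apply: h; rewrite ltrDl.
Qed.

Definition vol (r : R) : R := fine (mu (eball n r)).

Lemma volE r : mu (eball n r) = (vol r)%:E.
Proof. by rewrite /vol fineK// ge0_fin_numE// lebesgue_eball_lty. Qed.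

Lemma vol_ge0 r : 0 <= vol r.
Proof. by rewrite fine_ge0. Qed.

Lemma vol_gt0 r : 0 < r -> 0 < vol r.
Proof. by move=> r0; rewrite -lte_fin -volE; exact: lebesgue_eball_gt0. Qed.

Lemma le_vol r s : r <= s -> vol r <= vol s.
Proof. by move=> rs; rewrite -lee_fin -!volE; exact: le_lebesgue_eball. Qed.

Lemma vol_unbounded (u : R) : exists r, u < vol r.
Proof.
(* For the radius v (n + 1) / 2 the inscribed cube has side v, and v <= v^n since v >= 1 and n >
   0. *)
pose v := Num.max 1 u + 1.
have v1 : 1 <= v by rewrite /v lerDr le_max ler01.
have v0 : 0 < v by apply: lt_le_trans v1.
exists (v * n.+1%:R / 2); rewrite -lte_fin -volE.
apply: (@lt_le_trans _ _ v%:E).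
  by rewrite lte_fin /v (le_lt_trans _ (_ : Num.max 1 u < _))// ?le_max ?lexx ?orbT// ltrDl.
apply: le_trans (lebesgue_eball_ge _); last by rewrite divr_gt0// mulr_gt0.
rewrite lee_fin (_ : _ *+ 2 = v); last first.
  by rewrite -[LHS]mulr_natr mulrAC divfK ?pnatr_eq0// mulfK ?pnatr_eq0.
by rewrite -[leLHS]expr1 ler_weXn2l.
Qed.

(* The volume of the ball through y. *)
Definition nvol (y : X) : R := vol (enorm y).

Lemma nvol_ge0 y : 0 <= nvol y. Proof. exact: vol_ge0. Qed.

Lemma measurable_nvol : measurable_fun [set: X] nvol.
Proof.
apply: (measurableT_comp _ measurable_enorm).
by apply: nondecreasing_measurable => //; exact: le_vol.
Qed.

Lemma measurable_nvol_le u : measurable [set y | nvol y <= u].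
Proof.
rewrite (_ : [set _ | _] = nvol @^-1` `]-oo, u]%classic).
  by rewrite -[X in measurable X]setTI; exact: measurable_nvol.
by apply/seteqP; split=> x; rewrite /= in_itv.
Qed.

(* Up to a null sphere, nvol y <= u means that |y| is less than the supremum of
   the radii r with vol n r <= u. *)
Lemma lebesgue_nvol_le (u : R) : 0 <= u -> mu [set y | nvol y <= u] = u%:E.
Proof.
move=> u0; pose S := [set r | 0 <= r /\ vol r <= u].
have S0 : S 0 by split=> //; rewrite /vol eball_le0// measure0.
have [b ub] := vol_unbounded u.
have Sb : has_sup S.
  split; first by exists 0.
  exists b => r [_ ru]; rewrite leNgt; apply/negP => br.
  by have := le_lt_trans (le_trans (le_vol (ltW br)) ru) ub; rewrite ltxx.
pose r0 := sup S.
have Slt s : s < r0 -> vol s <= u.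
  move=> sr; have [t [t0 tu] st] := sup_adherent (ltr01 : 0 < 1) Sb.
  have d0 : 0 < r0 - s by rewrite subr_gt0.
  have [t' [t'0 t'u]] := sup_adherent d0 Sb.
  rewrite opprB addrC subrK => st'.
  exact: le_trans (le_vol (ltW st')) t'u.
have Sgt s : r0 < s -> u < vol s.
  move=> rs; rewrite ltNge; apply/negP => su.
  have : s <= r0.
    apply: sup_upper_bound => //; split=> //.
    by apply: le_trans (ltW rs); exact: sup_upper_bound.
  by rewrite leNgt rs.
(* The volume is continuous in the radius, so it takes the value u at the supremum [r0]. *)
have <- : mu (eball n r0) = u%:E.
  apply/eqP; rewrite eq_le; apply/andP; split.
    by apply: lebesgue_eball_le => // s sr; rewrite volE lee_fin Slt.
  by apply: lebesgue_eball_ge_lim => s rs; rewrite volE lee_fin ltW// Sgt.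
apply/eqP; rewrite eq_le; apply/andP; split; last first.
  apply: le_measure; rewrite ?inE.
  - exact: measurable_eball.
  - exact: measurable_nvol_le.
  - by move=> x; exact: Slt.
have ms : measurable [set x : X | enorm x = r0].
  rewrite -[X in measurable X]setTI -[X in _ `&` X]/(@enorm R n @^-1` [set r0]).
  exact: measurable_enorm.
apply: (@le_trans _ _ (mu (eball n r0 `|` [set x : X | enorm x = r0]))).
  apply: le_measure; rewrite ?inE.
  - exact: measurable_nvol_le.
  - by apply: measurableU => //; exact: measurable_eball.
  - move=> x /= xu; have [xr|xr|xr] := ltgtP (enorm x) r0.
    + by left.
    + by have := Sgt _ xr; rewrite ltNge (_ : vol (enorm x) <= u).
    + by right.
rewrite measureU0//; first exact: measurable_eball.
exact: lebesgue_sphere.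
Qed.

Lemma lebesgue_nvol_oc (a b : R) : 0 <= a -> a <= b ->
  mu (nvol @^-1` `]a, b]%classic) = (b - a)%:E.
Proof.
move=> a0 ab; rewrite (_ : _ @^-1` _ = [set y | nvol y <= b] `\` [set y | nvol y <= a]).
  rewrite measureD//; try exact: measurable_nvol_le; last first.
    by rewrite /= lebesgue_nvol_le ?ltry// (le_trans a0).
  rewrite (_ : _ `&` _ = [set y | nvol y <= a]); last first.
    by rewrite setIidr// => y /= /le_trans; apply.
  by rewrite /= !lebesgue_nvol_le// (le_trans a0).
apply/seteqP; split=> y/=; rewrite in_itv/=.
  by move=> /andP[ay yb]; split=> //; apply/negP; rewrite -ltNge.
by move=> [-> /negP]; rewrite -ltNge => ->.
Qed.

End ball_volume.
Arguments vol {R} n r.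

(** * Radial integrals *)

Section integrals_on_line.
Context {R : realType}.
Local Notation leb := (@lebesgue_measure R).

(** The primitives used below involve ln or a power and may be singular at 0, hence 0 < a; integrals
    from 0 or up to infinity are reached by exhaustion. *)
Lemma ge0_FTC_gt0 (F f : R -> R) (a b : R) : 0 < a -> a <= b ->
  (forall x : R, 0 < x -> is_derive x 1 F (f x)) ->
  (forall x : R, 0 < x -> {for x, continuous f}) ->
  (\int[leb]_(x in `]a, b]) (f x)%:E = (F b - F a)%:E)%E.
Proof.
move=> a0; rewrite le_eqVlt => /predU1P[<- _ _|ab dF cf].
  by rewrite set_itvoc0 integral_set0 subrr.
have cf' : {within `[a, b], continuous f}.
  apply: continuous_in_subspaceT => x; rewrite inE/= in_itv/= => /andP[ax _].
  by apply: cf; exact: lt_le_trans ax.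
have cF (x : R) : 0 < x -> F y @[y --> x] --> F x.
  move=> x0; apply: differentiable_continuous; apply/derivable1_diffP.
  by have [] := dF _ x0.
rewrite integral_itv_obnd_cbnd; last first.
  apply: measurable_funS (_ : measurable_fun `[a, b] _) => //.
    exact: subset_itv_oc_cc.
  by apply/measurable_EFinP; exact: subspace_continuous_measurable_fun.
rewrite (@continuous_FTC2 _ f F)//.
  split.
  - move=> x; rewrite in_itv/= => /andP[ax _].
    by have [] := dF _ (lt_trans a0 ax).
  - by apply: cvg_at_right_filter; exact: cF.
  - by apply: cvg_at_left_filter; apply: cF; exact: lt_trans ab.
move=> x; rewrite in_itv/= => /andP[ax _].
by rewrite derive1E; have [_ ->] := dF _ (lt_trans a0 ax).
Qed.

(** Monotone convergence as a uniform bound; this is enough because only upper estimates of improper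
    integrals are used. *)
Lemma ge0_integral_bigcup_le d (T : measurableType d)
    (m : {measure set T -> \bar R}) (A : (set T)^nat) (f : T -> \bar R) c :
  nondecreasing_seq A -> (forall i, measurable (A i)) ->
  measurable_fun (\bigcup_i A i) f -> (forall x, (\bigcup_i A i) x -> (0 <= f x)%E) ->
  (forall i, (\int[m]_(x in A i) f x <= c)%E) ->
  (\int[m]_(x in \bigcup_i A i) f x <= c)%E.
Proof.
move=> ndA mA mf f0 fc.
have mfA i : measurable_fun (A i) f.
  by apply: measurable_funS mf; [exact: bigcupT_measurable|exact: bigcup_sup].
have fA0 i x : A i x -> (0 <= f x)%E by move=> Aix; apply: f0; exists i.
have /cvg_lim <- // := ge0_nondecreasing_set_cvg_integral (mu := m) ndA mA mfA fA0.
apply: lime_le; last exact: nearW.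
apply: ereal_nondecreasing_is_cvgn.
move=> i j ij.
exact: (ge0_nondecreasing_set_nondecreasing_integral m ndA mA mfA fA0 ij).
Qed.


Lemma continuous_ln_affine (b k x : R) : 0 < x ->
  {for x, continuous (fun u => b + k * ln u)}.
Proof.
move=> x0; apply: cvgD; first exact: cvg_cst.
by apply: cvgM; [exact: cvg_cst|exact: continuous_ln].
Qed.

Lemma is_derive_xln (x : R) : 0 < x -> is_derive x 1 (fun u : R => u * ln u) (1 + ln x).
Proof.
move=> x0; have h : is_derive x 1 (@ln R) x^-1 by exact: is_derive1_ln.
apply: is_derive_eq.
by rewrite /= /GRing.scale/= !mulr1 divff ?gt_eqF.
Qed.

Lemma integral_ln_lower_le (c : R) : 0 < c ->
  (\int[leb]_(u in `]0%R, c]) (ln c - ln u)%:E <= c%:E)%E.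
Proof.
move=> c0.
have E : \bigcup_i `]c / i.+1%:R, c]%classic = `]0, c]%classic :> set R.
  apply/seteqP; split => [x [i _]|x]/=; rewrite !in_itv/= => /andP[x0 xc]; rewrite ?xc.
    by rewrite andbT (le_lt_trans _ x0)// divr_ge0// ltW.
  exists (Num.truncn (c / x)) => //; rewrite /= in_itv/= xc andbT.
  rewrite ltr_pdivrMr// mulrC -ltr_pdivrMr//.
  exact: truncnS_gt.
rewrite -E; apply: ge0_integral_bigcup_le => //.
- move=> i j ij; apply/subsetPset => x/=; rewrite !in_itv/= => /andP[+ ->].
  rewrite andbT; apply: le_lt_trans.
  by rewrite ler_pM2l// lef_pV2 ?posrE// ler_nat.
- rewrite E; apply/measurable_EFinP; apply: measurable_funB => //.
  exact: measurable_funTS.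
- move=> x; rewrite E/= in_itv/= => /andP[x0 xc].
  by rewrite lee_fin subr_ge0 ler_ln.
move=> i; have i1 : 0 < c / i.+1%:R by rewrite divr_gt0.
have ic : c / i.+1%:R <= c.
  by rewrite ler_pdivrMr// -[leLHS]mulr1 ler_pM2l// ler1n.
have dF (x : R) : 0 < x ->
    is_derive x 1 (fun u : R => u * (1 + ln c) - u * ln u) (ln c - ln x).
  move=> x0; have h := is_derive_xln x0.
  apply: is_derive_eq.
  by rewrite /= /GRing.scale/= mulr1 mulr0 add0r; ring.
rewrite (ge0_FTC_gt0 i1 ic dF).
  rewrite lee_fin -subr_ge0.
  (* The primitive takes the value c at c, so only its value at the lower end has to be
     nonnegative. *)
  rewrite (_ : _ - _ = c / i.+1%:R * (1 + (ln c - ln (c / i.+1%:R)))); last by ring.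
  by apply: mulr_ge0; [exact: ltW|rewrite addr_ge0// subr_ge0 ler_ln].
move=> x x0; rewrite (_ : (fun _ => _) = (fun u => ln c + (-1) * ln u)).
  exact: continuous_ln_affine.
by apply/funext => u; rewrite mulN1r.
Qed.

(** The summand 1 makes u (ln u - ln a) a primitive; it vanishes at a, so no lower-order term
    remains. *)
Lemma integral_ln_upper (a b : R) : 0 < a -> a <= b ->
  (\int[leb]_(u in `]a, b]) (1 + (ln u - ln a))%:E = (b * (ln b - ln a))%:E)%E.
Proof.
move=> a0 ab.
have dF (x : R) : 0 < x ->
    is_derive x 1 (fun u : R => u * ln u - u * ln a) (1 + (ln x - ln a)).
  move=> x0; have h := is_derive_xln x0.
  apply: is_derive_eq.
  by rewrite /= /GRing.scale/= mulr1 mulr0 add0r; ring.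
rewrite (ge0_FTC_gt0 a0 ab dF).
  by congr EFin; ring.
move=> x x0; rewrite (_ : (fun _ => _) = (fun u => (1 - ln a) + 1 * ln u)).
  exact: continuous_ln_affine.
by apply/funext => u; ring.
Qed.

Lemma integral_powRN_le (a s : R) : 0 < a -> 1 < s ->
  (\int[leb]_(u in `]a, +oo[) (u `^ (- s))%:E <= (a `^ (1 - s) / (s - 1))%:E)%E.
Proof.
move=> a0 s1.
have E : \bigcup_i `]a, a + i%:R]%classic = `]a, +oo[%classic :> set R.
  apply/seteqP; split => [x [i _]|x]/=; rewrite !in_itv/= ?andbT.
    by move=> /andP[].
  move=> ax; exists (Num.truncn (x - a)).+1 => //; rewrite /= in_itv/= ax/=.
  by rewrite -lerBlDl ltW// truncnS_gt.
rewrite -E; apply: ge0_integral_bigcup_le => //.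
- move=> i j ij; apply/subsetPset => x/=; rewrite !in_itv/= => /andP[->/=].
  by move=> /le_trans; apply; rewrite lerD2l ler_nat.
- rewrite E; apply/measurable_EFinP; apply: measurable_funTS.
  exact: measurable_powR.
- by move=> x _; rewrite lee_fin powR_ge0.
move=> i; have ai : a <= a + i%:R by rewrite lerDl.
have s10 : 1 - s != 0 by rewrite subr_eq0 lt_eqF.
have dF (x : R) : 0 < x ->
    is_derive x 1 (fun u : R => (1 - s)^-1 * u `^ (1 - s)) (x `^ (- s)).
  move=> x0; have h := is_derive1_powR (1 - s) x0.
  apply: is_derive_eq.
  rewrite /= /GRing.scale/= mulrA mulVf// mul1r.
  by congr (_ `^ _); ring.
rewrite (ge0_FTC_gt0 a0 ai dF).
  rewrite lee_fin -subr_ge0.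
  rewrite (_ : _ - _ = (a + i%:R) `^ (1 - s) / (s - 1)).
    by rewrite divr_ge0// ?powR_ge0// subr_ge0 ltW.
  by rewrite -(opprB s 1) invrN; ring.
move=> x x0; apply: differentiable_continuous; apply/derivable1_diffP.
by have [] := is_derive1_powR (- s) x0.
Qed.

End integrals_on_line.

Section radial_integrals.
Context {R : realType} {n : nat}.
Hypothesis n_gt0 : (0 < n)%N.
Local Notation X := (Rn R n).
Local Notation mu := (@lebesgue R n).
Local Notation leb := (@lebesgue_measure R).

Lemma nvol_preimage_itv (A : set R) : measurable A -> measurable (@nvol R n @^-1` A).
Proof. by move=> mA; rewrite -[X in measurable X]setTI; exact: measurable_nvol. Qed.

(* Restricting Lebesgue measure to the negative half-line and adding it to the
   image of mu under nvol gives a measure on the whole line to which the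
   uniqueness theorem applies. *)
Lemma lebesgue_nvol_preimage (A : set R) : measurable A -> A `<=` `]0, +oo[ ->
  mu (@nvol R n @^-1` A) = leb A.
Proof.
move=> mA A0; pose mN : measurable (`]-oo, 0] : set (measurableTypeR R)) := measurable_itv _.
pose nu1 : {measure set (measurableTypeR R) -> \bar R} :=
  measure_function_pushforward__canonical__measure_function_Measure mu
    (@measurable_nvol R n : measurable_fun _ (_ : X -> measurableTypeR R)).
pose nu : {measure set (measurableTypeR R) -> \bar R} := measure_add nu1 (mrestr leb mN).
have nuE B : nu B = (mu (@nvol R n @^-1` B) + leb (B `&` `]-oo, 0%R]))%E.
  exact: measure_addE.
rewrite [RHS](lebesgue_measure_unique (mu := nu)) //.
  rewrite nuE (_ : A `&` _ = set0) ?measure0 ?adde0//.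
  apply/seteqP; split=> // x [/A0] /=; rewrite !in_itv/= andbT => x0.
  by rewrite leNgt x0.
move=> _ [[a b] _ <-]/=; rewrite nuE lebesgue_measure_itv/= lte_fin.
case: ifPn => [ab|]; last first.
  rewrite -leNgt => ba; rewrite set_itv_ge ?bnd_simp -?leNgt//.
  by rewrite preimage_set0 set0I !measure0 adde0.
have [a0|a0] := leP 0 a.
  rewrite lebesgue_nvol_oc// ?ltW// (_ : _ `&` _ = set0) ?measure0 ?adde0//.
  apply/seteqP; split=> // x [] /=; rewrite !in_itv/= => /andP[ax _].
  by rewrite leNgt (le_lt_trans a0).
have [b0|b0] := leP 0 b.
  rewrite (_ : _ @^-1` _ = [set y | nvol y <= b]); last first.
    apply/seteqP; split=> y/=; rewrite in_itv/=; first by case/andP.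
    by move=> ->; rewrite andbT (lt_le_trans a0)// nvol_ge0.
  rewrite lebesgue_nvol_le//.
  rewrite (_ : _ `&` _ = `]a, 0]%classic); last first.
    apply/seteqP; split=> y/=; rewrite !in_itv/=.
      by move=> [/andP[-> _] ->].
    by move=> /andP[-> y0]; rewrite y0/= (le_trans y0).
  by rewrite lebesgue_measure_itv/= lte_fin a0 -!EFinD sub0r.
rewrite (_ : _ @^-1` _ = set0); last first.
  apply/seteqP; split=> // y/=; rewrite in_itv/= => /andP[_ yb].
  by have := lt_le_trans b0 (nvol_ge0 y); rewrite ltNge yb.
rewrite measure0 add0e (_ : _ `&` _ = `]a, b]%classic).
  by rewrite lebesgue_measure_itv/= lte_fin ab.
apply/seteqP; split=> y/=; rewrite !in_itv/=; first by case.
by move=> /andP[-> yb]; rewrite yb (le_trans yb)// ltW.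
Qed.

(** The image of [mu] under [nvol] and Lebesgue measure agree on subsets of the positive half-line
    only, which suffices for integrals over such a D. *)
Lemma ge0_integral_nvol (D : set R) (F : R -> \bar R) : measurable D ->
  D `<=` `]0, +oo[ -> measurable_fun D F -> (forall u, D u -> (0 <= F u)%E) ->
  (\int[mu]_(y in @nvol R n @^-1` D) F (nvol y) = \int[leb]_(u in D) F u)%E.
Proof.
move=> mD D0 mF F0.
have F0' : {in D, forall u, (0 <= F u)%E} by move=> u /[!inE]; exact: F0.
rewrite -[LHS](@ge0_integral_pushforward _ _ X (measurableTypeR R) R _
  (@measurable_nvol R n) mu D F mD mF F0').
pose nu : {measure set (measurableTypeR R) -> \bar R} :=
  measure_function_pushforward__canonical__measure_function_Measure mu
    (@measurable_nvol R n : measurable_fun _ (_ : X -> measurableTypeR R)).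
transitivity (\int[nu]_(u in (D : set (measurableTypeR R))) F u)%E; first by [].
apply: (@eq_measure_integral _ (measurableTypeR R) R D leb nu F) => A mA AD.
by apply: lebesgue_nvol_preimage => //; exact: subset_trans AD D0.
Qed.

Lemma ge0_integral_eball_nvol (r : R) (F : R -> \bar R) : 0 < r ->
  measurable_fun [set: R] F -> (forall u, 0 <= u -> (0 <= F u)%E) ->
  (\int[mu]_(y in eball n r) F (nvol y) =
   \int[leb]_(u in `]0%R, vol n r]) F u)%E.
Proof.
move=> r0 mF F0.
have mFn : measurable_fun [set: X] (F \o @nvol R n).
  exact: (measurableT_comp mF (@measurable_nvol R n)).
have mU := measurable_nvol_le (n := n) (vol n r).
have mZ := @measurable_nvol_le R n 0.
have mB := @measurable_eball R n r.
have subBU : eball n r `<=` [set y : X | nvol y <= vol n r].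
  by move=> y yr; apply: le_vol; exact: ltW.
have eqv : mu ([set y | nvol y <= vol n r] `\` eball n r) = 0%E.
  rewrite measureD//; last by rewrite /= lebesgue_nvol_le ?ltry// vol_ge0.
  rewrite /= setIidr// volE lebesgue_nvol_le ?vol_ge0//.
  by rewrite subee.
(* The ball and the preimage of ]0, vol n r] differ only inside N: at the points with [nvol] equal
   to 0, and at the points outside the ball with [nvol] at most [vol n r]. *)
pose N := [set y : X | nvol y <= 0] `|` ([set y | nvol y <= vol n r] `\` eball n r).
have mN : measurable N by apply: measurableU => //; exact: measurableD.
have N0 : mu N = 0%E.
  rewrite measureU0//; last exact: measurableD.
  exact: lebesgue_nvol_le.
rewrite -(ge0_integral_nvol (D := `]0, vol n r]%classic))//=; last 3 first.
- by move=> u/=; rewrite !in_itv/= => /andP[->].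
- exact: measurable_funTS.
- by move=> u; rewrite in_itv/= => /andP[u0 _]; apply: F0; exact: ltW.
have mO : measurable (@nvol R n @^-1` `]0, vol n r]%classic).
  exact: nvol_preimage_itv.
have Fn0 (y : X) : (0 <= F (nvol y))%E by apply: F0; exact: nvol_ge0.
rewrite (ge0_negligible_integral mN mB (measurable_funTS mFn) (fun y _ => Fn0 y) N0).
rewrite [RHS](ge0_negligible_integral mN mO (measurable_funTS mFn) (fun y _ => Fn0 y) N0).
congr (integral _ _ _); apply/seteqP; split => y [] h Ny; split=> //.
- rewrite /= in_itv/=; apply/andP; split; last exact: subBU.
  by rewrite ltNge; apply/negP => y0; apply: Ny; left.
- apply: contrapT => yr; apply: Ny; right; split=> //.
  by move: h; rewrite /= in_itv/= => /andP[].
Qed.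

End radial_integrals.

(** * Convex gauges and Jensen's inequality *)

Section measurable_ereal_functions.
Context {R : realType}.
Local Open Scope ereal_scope.

(** The hypothesis is a Galois connection: the preimage by g of a ray starting at r is the ray
    starting at k r. It serves [lne] and [expeR], each being k for the other. *)
Lemma measurable_homo_ge (g k : \bar R -> \bar R) :
  (forall r x, (r%:E <= g x) = (k r%:E <= x)) ->
  measurable_fun [set: \bar R] g.
Proof.
move=> gk mD; apply: (measurability _ (ErealGenCInfty.measurableE R)) => //.
move=> _ [_ [r ->] <-]; rewrite setTI.
rewrite (_ : _ @^-1` _ = `[k r%:E, +oo[%classic); first exact: emeasurable_itv.
by apply/seteqP; split=> x /=; rewrite !in_itv/= !andbT gk.
Qed.

Lemma measurable_lne : measurable_fun [set: \bar R] (@lne R).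
Proof.
apply: (@measurable_homo_ge _ (@expeR R)) => r x.
have [x0|x0] := leP x 0.
  rewrite le0_lneNy//; apply/esym/negbTE; rewrite -ltNge.
  by rewrite (le_lt_trans x0)// expeR_gt0// ltNyr.
by rewrite -lee_expeR lneK// in_itv/= leey ltW.
Qed.

Lemma measurable_expeR : measurable_fun [set: \bar R] (@expeR R).
Proof.
apply: (@measurable_homo_ge _ (@lne R)) => r x.
have [r0|r0] := leP r 0%R.
  by rewrite le0_lneNy ?lee_fin// leNye (le_trans _ (expeR_ge0 _))// lee_fin.
by rewrite -[in RHS]lee_expeR lneK// in_itv/= leey lee_fin ltW.
Qed.

Lemma lne_inve (x : \bar R) : 0 < x -> lne x^-1 = - lne x.
Proof.
case: x => [r|_|//]; last by rewrite invey/= lexx.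
by rewrite lte_fin => r0; rewrite inver gt_eqF// lneV.
Qed.

End measurable_ereal_functions.

(** [phi_ext] with the point x fixed, so that one-variable convexity applies; it is used for psi x,
    in the variable t^p. *)
Definition cext {R : realType} (psi : R -> R) (t : \bar R) : \bar R :=
  match t with
  | r%:E => (psi r)%:E
  | _ => ereal_sup [set (psi r)%:E | r in [set r | 0 <= r]]
  end.

Section convex_gauge.
Context {R : realType}.
Variable psi : R -> R.
Hypothesis psi_ge0 : forall t, 0 <= t -> 0 <= psi t.
Hypothesis psi_conv : @convex_function R R^o `[0, +oo[ psi.
Hypothesis psi0 : psi 0 = 0.

Lemma convex3 a t b : 0 <= a -> a < t -> t < b ->
  (b - a) * psi t <= (b - t) * psi a + (t - a) * psi b.
Proof.
move=> a0 at_ tb; have ab : 0 < b - a by rewrite subr_gt0 (lt_trans at_).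
have l0 : 0 <= (b - t) / (b - a) by apply: divr_ge0; [rewrite subr_ge0 ltW|exact: ltW].
have l1 : (b - t) / (b - a) <= 1 by rewrite ler_pdivrMr// mul1r lerB// ltW.
have b0 : 0 <= b by rewrite (le_trans a0)// ltW// (lt_trans at_).
have ia : (a : R^o) \in (`[0, +oo[%classic : set R^o) by rewrite inE/= in_itv/= a0.
have ib : (b : R^o) \in (`[0, +oo[%classic : set R^o) by rewrite inE/= in_itv/= b0.
pose l := (b - t) / (b - a).
have h : psi (l * a + (1 - l) * b) <= l * psi a + (1 - l) * psi b.
  exact: (psi_conv (Itv01 l0 l1) ia ib).
have E : l * a + (1 - l) * b = t by rewrite /l; field; rewrite gt_eqF.
move/(ler_wpM2l (ltW ab)): h; rewrite E => /le_trans; apply.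
rewrite le_eqVlt; apply/orP; left; apply/eqP.
rewrite /l; field; rewrite gt_eqF//.
Qed.

(** The slope c is the supremum of the left difference quotients at t0, which are bounded by every
    right one ([convex3]); the quotient taken from 0 shows c >= 0. *)
Lemma supporting_line t0 : 0 < t0 ->
  exists2 c, 0 <= c & forall t, 0 <= t -> psi t0 + c * (t - t0) <= psi t.
Proof.
move=> t00.
pose S := [set (psi t0 - psi a) / (t0 - a) | a in [set a | 0 <= a < t0]].
have ub b : t0 < b -> ubound S ((psi b - psi t0) / (b - t0)).
  move=> tb _ [a /andP[a0 at0] <-].
  have := convex3 a0 at0 tb.
  rewrite ler_pdivrMr ?subr_gt0// mulrAC ler_pdivlMr ?subr_gt0// => h.
  by nra.
have S0 : S (psi t0 / t0) by exists 0 => /=; [rewrite lexx t00|rewrite psi0 !subr0].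
have supS : has_sup S.
  split; first by exists (psi t0 / t0).
  by exists ((psi (t0 + 1) - psi t0) / (t0 + 1 - t0)); apply: ub; rewrite ltrDl.
exists (sup S).
  apply: (@le_trans _ _ (psi t0 / t0)); last exact: sup_upper_bound.
  by rewrite divr_ge0 ?psi_ge0 ?ltW.
move=> t tge0; have [tt0|tt0|->] := ltgtP t t0; last by rewrite subrr mulr0 addr0.
  have : (psi t0 - psi t) / (t0 - t) <= sup S.
    by apply: sup_upper_bound => //; exists t => //=; rewrite tge0.
  by rewrite ler_pdivrMr ?subr_gt0//; lra.
have : sup S <= (psi t - psi t0) / (t - t0).
  by apply: ge_sup; [exists (psi t0 / t0)|exact: ub].
by rewrite ler_pdivlMr ?subr_gt0//; lra.
Qed.

Lemma convex_gauge_nd s t : 0 <= s -> s <= t -> psi s <= psi t.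
Proof.
rewrite le_eqVlt => /predU1P[<-|s0 st]; first by rewrite psi0; exact: psi_ge0.
have [c c0 /(_ t (le_trans (ltW s0) st))] := supporting_line s0.
apply: le_trans; rewrite lerDl mulr_ge0// subr_ge0//.
Qed.

Local Open Scope ereal_scope.

Lemma cext_le_pinfty r : (0 <= r)%R -> (psi r)%:E <= cext psi +oo.
Proof. by move=> r0; apply: ereal_sup_ubound; exists r. Qed.

Lemma cext_ge0 u : 0 <= u -> 0 <= cext psi u.
Proof.
case: u => [r|_|//]; first by rewrite !lee_fin; exact: psi_ge0.
by apply: le_trans (cext_le_pinfty (lexx 0%R)); rewrite psi0.
Qed.

Lemma cext_nd u u' : 0 <= u -> u <= u' -> cext psi u <= cext psi u'.
Proof.
case: u => [r|_|//]; case: u' => [r'||]//.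
- by rewrite !lee_fin; exact: convex_gauge_nd.
- by rewrite lee_fin => r0 _; exact: cext_le_pinfty.
Qed.

(** The tangent inequality with its negative term moved to the right, so that both sides are sums of
    nonnegative extended reals. For k = +oo and c > 0 the tangent forces [psi] to be unbounded. *)
Lemma cext_affine_le t0 c k : (0 <= c)%R ->
  (forall t, 0 <= t -> psi t0 + c * (t - t0) <= psi t)%R -> (0 <= t0)%R ->
  0 <= k -> (psi t0)%:E + c%:E * k <= cext psi k + (c * t0)%:E.
Proof.
move=> c0 h t00; case: k => [r|_|//].
  rewrite lee_fin => r0 /=; rewrite -!EFinD lee_fin.
  by have := h _ r0; lra.
have [->|cn0] := eqVneq c 0%R.
  by rewrite mul0e adde0 mul0r adde0; exact: cext_le_pinfty.
suff -> : cext psi +oo = +oo by rewrite leey.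
apply/eqyP => A A0.
pose t := (t0 + A / c)%R.
have cp : (0 < c)%R by rewrite lt0r cn0.
have tt : (0 <= t)%R by rewrite addr_ge0// divr_ge0// ltW.
apply: le_trans (cext_le_pinfty tt); rewrite lee_fin.
apply: le_trans (h _ tt); rewrite /t addrAC subrr add0r mulrC divfK//.
by rewrite lerDr psi_ge0.
Qed.

Lemma cext_approx u (c : R) : 0 <= u -> c%:E < cext psi u ->
  exists2 t, (0 <= t)%R /\ t%:E <= u & (c < psi t)%R.
Proof.
case: u => [r|_|//].
  by rewrite lee_fin lte_fin => r0 cr; exists r.
by move=> /ereal_sup_gt[_ [r r0 <-]]; rewrite lte_fin; exists r; rewrite ?leey.
Qed.

(** Left continuity, from the tangent line at t. The absolute value makes every rational an
    admissible argument, so that all of them can be enumerated. *)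
Lemma convex_gauge_left_approx t (c : R) : (0 <= t)%R -> (c < psi t)%R ->
  exists q : rat, let r := `|ratr q|%R : R in (r <= t)%R /\ (c < psi r)%R.
Proof.
rewrite le_eqVlt => /predU1P[<- c0|t0 ct].
  by exists 0%Q => /=; rewrite rmorph0 normr0.
have [k k0 hk] := supporting_line t0.
have kp : (0 < k + 1)%R by rewrite ltr_wpDl.
(* The denominator is k + 1 because k may be 0. Within distance e to the left of t, the tangent of
   slope k stays above psi t - k e = c + e. *)
pose e := ((psi t - c) / (k + 1))%R.
have e0 : (0 < e)%R by rewrite divr_gt0// subr_gt0.
have : (Num.max 0 (t - e) < t)%R by rewrite gt_max t0/= gtrBl.
move=> /rat_in_itvoo[q]; rewrite in_itv/= gt_max => /andP[/andP[q0 qe] qt].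
exists q => /=; rewrite ger0_norm ?(ltW q0)//; split; first exact: ltW.
apply: lt_le_trans (hk _ (ltW q0)).
have ee : (e * (k + 1) = psi t - c)%R by rewrite /e divfK// gt_eqF.
by nra.
Qed.

(* By left continuity the supremum over [0, u] may be taken over rational points,
   hence it is countable: this is what makes [cext] measurable. *)
Lemma cext_sup_rat u : 0 <= u -> cext psi u = ereal_sup (range (fun i : nat =>
  let r := `|ratr (odflt 0%Q (unpickle i))|%R : R in
  if r%:E <= u then (psi r)%:E else 0)).
Proof.
move=> u0; apply/eqP; rewrite eq_le; apply/andP; split; last first.
  apply: ge_ereal_sup => _ [i _ <-] /=; case: ifPn => [h|_]; last exact: cext_ge0.
  by rewrite -[leLHS]/(cext psi _%:E); apply: cext_nd => //; rewrite lee_fin.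
rewrite leNgt; apply/negP.
set S := ereal_sup _ => Su.
have Sge (q : rat) : `|ratr q|%:E <= u -> (psi `|ratr q|)%:E <= S.
  move=> qu; apply: ereal_sup_ubound; exists (pickle q) => //.
  by rewrite pickleK/= qu.
have S0 : 0 <= S.
  by have := Sge 0%R; rewrite rmorph0 normr0 psi0; apply.
have Sfin : S \is a fin_num by rewrite ge0_fin_numE// (lt_le_trans Su) ?leey.
rewrite -(fineK Sfin) in Su.
have [t [t0 tu] St] := cext_approx u0 Su.
have [q [qt Sq]] := convex_gauge_left_approx t0 St.
have : (psi `|ratr q|)%:E <= S.
  by apply: Sge; rewrite (le_trans _ tu)// lee_fin.
by rewrite -(fineK Sfin) lee_fin leNgt Sq.
Qed.

End convex_gauge.

Section gauge_measurable.
Context {R : realType}.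
Local Open Scope ereal_scope.

Definition gauge (psi : R -> R) :=
  [/\ forall t, (0 <= t -> 0 <= psi t)%R,
      @convex_function R R^o `[0%R, +oo[ psi & psi 0%R = 0%R].

Lemma gauge_cext_ge0 psi u : gauge psi -> 0 <= u -> 0 <= cext psi u.
Proof. by move=> [? ? ?]; exact: cext_ge0. Qed.

Lemma gauge_cext_nd psi u u' : gauge psi -> 0 <= u -> u <= u' ->
  cext psi u <= cext psi u'.
Proof. by move=> [? ? ?]; exact: cext_nd. Qed.

Lemma measurable_cext d (T : measurableType d) (Psi : T -> R -> R)
    (U : T -> \bar R) :
  (forall z, gauge (Psi z)) ->
  (forall t, (0 <= t)%R -> measurable_fun [set: T] (Psi ^~ t)) ->
  measurable_fun [set: T] U -> (forall z, 0 <= U z) ->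
  measurable_fun [set: T] (fun z => cext (Psi z) (U z)).
Proof.
move=> gP mP mU U0.
pose q (i : nat) := `|ratr (odflt 0%Q (unpickle i))|%R : R.
pose f i z := if (q i)%:E <= U z then (Psi z (q i))%:E else 0.
(* [esups] at index 0 is the supremum of the whole sequence, as in [cext_sup_rat]. *)
rewrite (_ : (fun z => _) = (fun z => esups (f ^~ z) 0%N)).
  apply: measurable_fun_esups => i; apply: measurable_fun_ifT => //.
    apply: (measurable_fun_bool true).
    rewrite (_ : _ @^-1` _ = U @^-1` `[(q i)%:E, +oo[).
      by apply: mU => //; exact: emeasurable_itv.
    by apply/seteqP; split=> z /=; rewrite in_itv/= andbT.
  by apply/measurable_EFinP; apply: mP; exact: normr_ge0.
apply/funext => z; have [P0 Pc P00] := gP z.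
rewrite (cext_sup_rat P0 Pc P00)//; congr ereal_sup.
by apply/seteqP; split=> _ [i _ <-]; exists i.
Qed.

(** Jensen's inequality for the measure h dy of mass H, with u at most the mean of k. The tangent at
    a real t0 <= u is integrated and the finite term c t0 H cancelled; then t0 = u or, for u = +oo,
    the supremum over t0 is taken. Thus u and k may be infinite. *)
Lemma jensen_cext d (T : measurableType d) (mu : {measure set T -> \bar R})
    psi (h k : T -> \bar R) u : gauge psi ->
  measurable_fun [set: T] h -> (forall y, 0 <= h y) ->
  measurable_fun [set: T] k -> (forall y, 0 <= k y) ->
  0 < \int[mu]_y h y -> \int[mu]_y h y < +oo -> 0 <= u ->
  u * \int[mu]_y h y <= \int[mu]_y (k y * h y) ->
  cext psi u * \int[mu]_y h y <= \int[mu]_y (cext psi (k y) * h y).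
Proof.
move=> gpsi mh h0 mk k0.
have mc : measurable_fun [set: T] (fun y => cext psi (k y)).
  by apply: measurable_cext.
have c0 y : 0 <= cext psi (k y) by exact: gauge_cext_ge0.
set H := \int[mu]_y h y => H0 Hoo u0 uH.
have Hfin : H \is a fin_num by rewrite ge0_fin_numE// ltW.
have [P0 Pc P00] := gpsi.
set J := (leRHS).
have J0 : 0 <= J by apply: integral_ge0 => y _; rewrite mule_ge0.
have key t0 : (0 <= t0)%R -> t0%:E <= u -> (psi t0)%:E * H <= J.
  rewrite le_eqVlt => /predU1P[<- _|t00 t0u]; first by rewrite P00 mul0e.
  have [c cge0 hc] := supporting_line P0 Pc P00 t00.
  have [->|Joo] := eqVneq J +oo; first exact: leey.
  have Jfin : J \is a fin_num by rewrite ge0_fin_numE// ltey.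
  have t0c : 0 <= (c * t0)%:E by rewrite lee_fin mulr_ge0// ltW.
  have : \int[mu]_y ((psi t0)%:E * h y + c%:E * (k y * h y)) <=
      \int[mu]_y (cext psi (k y) * h y + (c * t0)%:E * h y).
    apply: ge0_le_integral => //.
    - move=> y _; apply: adde_ge0; first by rewrite mule_ge0// lee_fin P0// ltW.
      by rewrite !mule_ge0// lee_fin.
    - apply: emeasurable_funD; first exact: measurable_funeM.
      by apply: measurable_funeM; exact: emeasurable_funM.
    - apply: emeasurable_funD; first exact: emeasurable_funM.
      exact: measurable_funeM.
    - move=> y _; rewrite muleA -ge0_muleDl//; last 2 first.
      + by rewrite lee_fin P0// ltW.
      + by rewrite mule_ge0// lee_fin.
      rewrite -ge0_muleDl//; apply: lee_wpmul2r => //.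
      by apply: cext_affine_le => //; exact: ltW.
  rewrite ge0_integralD//; last 4 first.
  - by move=> y _; rewrite mule_ge0// lee_fin P0// ltW.
  - exact: measurable_funeM.
  - by move=> y _; rewrite !mule_ge0// lee_fin.
  - by apply: measurable_funeM; exact: emeasurable_funM.
  rewrite ge0_integralD//; last 4 first.
  - by move=> y _; rewrite mule_ge0.
  - exact: emeasurable_funM.
  - by move=> y _; rewrite mule_ge0.
  - exact: measurable_funeM.
  rewrite -/J.
  have Z (c' : R) (g : T -> \bar R) : (0 <= c')%R -> measurable_fun [set: T] g ->
      (forall y, 0 <= g y) -> \int[mu]_y (c'%:E * g y) = c'%:E * \int[mu]_y g y.
    by move=> c'0 mg g0; rewrite ge0_integralZl.
  rewrite !Z//.
  all: try exact: emeasurable_funM.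
  all: try by move=> y; rewrite mule_ge0.
  all: try by rewrite ?P0// ?mulr_ge0// ltW.
  rewrite -/H => h1.
  have : (psi t0)%:E * H + (c * t0)%:E * H <= J + (c * t0)%:E * H.
    apply: le_trans h1; apply: leeD => //.
    rewrite EFinM -muleA; apply: lee_wpmul2l; first by rewrite lee_fin.
    by apply: le_trans uH; apply: lee_wpmul2r => //; exact: ltW.
  by rewrite leeD2rE// fin_numM.
have [uoo|uoo] := eqVneq u +oo; last first.
  have ufin : u \is a fin_num by rewrite ge0_fin_numE// ltey.
  rewrite -(fineK ufin); apply: key; first exact: fine_ge0.
  by rewrite fineK.
rewrite uoo -(fineK Hfin) muleC -lee_pdivlMl; last first.
  by rewrite fine_gt0// H0.
apply: ge_ereal_sup => _ [r r0 <-].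
rewrite lee_pdivlMl; last by rewrite fine_gt0// H0.
by rewrite fineK// muleC; apply: key => //; rewrite uoo leey.
Qed.

End gauge_measurable.

(** * Integrals that may be infinite *)

Section semi_integrable.
Context d (T : measurableType d) {R : realType}.
Variables (mu : {measure set T -> \bar R}) (D : set T).
Hypothesis mD : measurable D.
Local Open Scope ereal_scope.

(** The integral is the difference of those of the positive and negative parts, with oo - oo = -oo.
    Comparing the parts separately therefore requires no integrability. *)
Lemma ae_le_integral (f g : T -> \bar R) :
  measurable_fun D f -> measurable_fun D g ->
  {ae mu, forall x, D x -> f x <= g x} ->
  \int[mu]_(x in D) f x <= \int[mu]_(x in D) g x.
Proof.
move=> mf mg fg; rewrite integralE [leRHS]integralE; apply: leeB.
- apply: ae_ge0_le_integral => //; try exact: measurable_funepos.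
  apply: filterS fg => x fg Dx; rewrite !funeposE.
  by rewrite ge_max !le_max fg// lexx orbT.
- apply: ae_ge0_le_integral => //; try exact: measurable_funeneg.
  apply: filterS fg => x fg Dx; rewrite !funenegE.
  by rewrite ge_max !le_max leeN2 fg// lexx orbT.
Qed.

Lemma funepos_addr_lty (a : T -> \bar R) (b : T -> R) :
  measurable_fun D a -> mu.-integrable D (EFin \o b) ->
  \int[mu]_(x in D) a^\+ x < +oo ->
  \int[mu]_(x in D) (fun y => a y + (b y)%:E)^\+ x < +oo.
Proof.
move=> ma ib aoo.
have mb := measurable_int _ ib.
have mab : measurable_fun D (fun y => a y + (b y)%:E) by exact: emeasurable_funD.
apply: (@le_lt_trans _ _ (\int[mu]_(x in D) (a^\+ x + `|(b x)%:E|))).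
  apply: ge0_le_integral => //.
  - exact: measurable_funepos.
  - apply: emeasurable_funD; first exact: measurable_funepos.
    exact: measurableT_comp.
  - move=> x Dx; rewrite !funeposE ge_max; apply/andP; split; last first.
      by rewrite adde_ge0// le_max lexx orbT.
    apply: leeD; first by rewrite le_max lexx.
    by rewrite lee_fin ler_norm.
rewrite ge0_integralD//; last 2 first.
- exact: measurable_funepos.
- exact: measurableT_comp.
by rewrite lte_add_pinfty//; have /integrableP[] := ib.
Qed.

Lemma funeneg_addr_lty (a : T -> \bar R) (b : T -> R) :
  measurable_fun D a -> mu.-integrable D (EFin \o b) ->
  \int[mu]_(x in D) a^\- x < +oo ->
  \int[mu]_(x in D) (fun y => a y + (b y)%:E)^\- x < +oo.
Proof.
move=> ma ib aoo.
have := @funepos_addr_lty (fun y => - a y) (fun y => - b y)%R.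
rewrite (_ : (fun y => - a y)^\+ = a^\-); last first.
  by apply/funext => y; rewrite funeposE funenegE.
rewrite (_ : (fun y => - a y + (- b y)%:E)^\+ = (fun y => a y + (b y)%:E)^\-).
  apply => //; first exact: measurableT_comp.
  exact: (integrableN ib).
apply/funext => y; rewrite funeposE funenegE fin_num_oppeD//.
Qed.

(* [integralD] requires both functions to be integrable. *)
Lemma integralD_semi (a : T -> \bar R) (b : T -> R) :
  measurable_fun D a -> mu.-integrable D (EFin \o b) ->
  \int[mu]_(x in D) a^\+ x < +oo \/ \int[mu]_(x in D) a^\- x < +oo ->
  \int[mu]_(x in D) (a x + (b x)%:E) =
  \int[mu]_(x in D) a x + \int[mu]_(x in D) (b x)%:E.
Proof.
move=> ma ib aoo.
have mb := measurable_int _ ib.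
have mab : measurable_fun D (fun y => a y + (b y)%:E) by exact: emeasurable_funD.
have bfin : \int[mu]_(x in D) (b x)%:E \is a fin_num by exact: integrable_fin_num.
have Nib : mu.-integrable D (EFin \o (fun y => - b y)%R) by exact: (integrableN ib).
have aE : (fun y => (a y + (b y)%:E) + (- b y)%:E) = a.
  by apply/funext => y; rewrite EFinN addeK.
(* Adding -b to a + b transfers finiteness back: a part of a + b has infinite integral exactly when
   the same part of a has. *)
have posab : \int[mu]_(x in D) (fun y => a y + (b y)%:E)^\+ x < +oo ->
    \int[mu]_(x in D) a^\+ x < +oo.
  by move=> /(funepos_addr_lty mab Nib); rewrite aE.
have negab : \int[mu]_(x in D) (fun y => a y + (b y)%:E)^\- x < +oo ->
    \int[mu]_(x in D) a^\- x < +oo.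
  by move=> /(funeneg_addr_lty mab Nib); rewrite aE.
have pos0 c : 0 <= \int[mu]_(x in D) c^\+ x by exact: integral_ge0.
have neg0 c : 0 <= \int[mu]_(x in D) c^\- x by exact: integral_ge0.
have [pa|pa] := eqVneq (\int[mu]_(x in D) a^\+ x) +oo.
  have na : \int[mu]_(x in D) a^\- x < +oo by case: aoo => //; rewrite pa.
  have nab := funeneg_addr_lty ma ib na.
  have pab : \int[mu]_(x in D) (fun y => a y + (b y)%:E)^\+ x = +oo.
    by apply/eqP; rewrite -leye_eq leNgt; apply/negP => /posab; rewrite pa.
  rewrite integralE pab [X in _ = X + _]integralE pa.
  have ysub (z : \bar R) : z < +oo -> +oo - z = +oo by case: z.
  by rewrite !ysub// addye//; move: bfin; rewrite fin_numE => /andP[].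
have [na|na] := eqVneq (\int[mu]_(x in D) a^\- x) +oo.
  have nab : \int[mu]_(x in D) (fun y => a y + (b y)%:E)^\- x = +oo.
    by apply/eqP; rewrite -leye_eq leNgt; apply/negP => /negab; rewrite na.
  by rewrite integralE nab [X in _ = X + _]integralE na !addeNy.
rewrite integralD//; apply/integrableP; split => //.
rewrite -[X in integral _ _ X]/(abse \o a) fune_abse ge0_integralD//.
- by rewrite lte_add_pinfty// ltey.
- exact: measurable_funepos.
- exact: measurable_funeneg.
Qed.

End semi_integrable.

Section ereal_inverse.
Context {R : realType}.
Local Open Scope ereal_scope.

(** Writes the inverse through [lne] and [expeR], whose measurability is established; at 0 both
    sides are +oo. *)
Lemma inve_expeR (u : \bar R) : 0 <= u -> u^-1 = expeR (- lne u).
Proof.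
case: u => [r|_|//]; last by rewrite invey.
rewrite le_eqVlt => /predU1P[<-|r0]; first by rewrite inve0 /= lexx.
by rewrite inver gt_eqF// lne_EFin//= expRN lnK.
Qed.

End ereal_inverse.

(** * Averages of functions of bounded modular *)

Section sublevel_integrals.
Context d (T : measurableType d) {R : realType}.
Variable mu : {sigma_finite_measure set T -> \bar R}.
Local Open Scope ereal_scope.

Lemma measurable_sublevel2 (N : T -> R) : measurable_fun [set: T] N ->
  measurable_fun [set: T * T] (fun z => \1_[set w : T * T | (N w.2 < N w.1)%R] z : R).
Proof.
move=> mN; apply: measurable_indic.
have m1 : measurable_fun [set: T * T] (fun z => N z.1).
  exact: (measurableT_comp mN measurable_fst).
have m2 : measurable_fun [set: T * T] (fun z => N z.2).
  exact: (measurableT_comp mN measurable_snd).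
have := measurable_fun_ltr m2 m1.
move=> /(_ measurableT [set true] I); by rewrite setTI; congr measurable.
Qed.

(** The varying domain is a section of the set of pairs with N y < N x, so Tonelli's theorem applies
    to each part of h. *)
Lemma measurable_integral_sublevel (N : T -> R) (h : T -> \bar R) :
  measurable_fun [set: T] N -> measurable_fun [set: T] h ->
  measurable_fun [set: T] (fun x => \int[mu]_(y in [set y | (N y < N x)%R]) h y).
Proof.
move=> mN mh.
have key g : measurable_fun [set: T] g -> (forall y, 0 <= g y) ->
    measurable_fun [set: T] (fun x => \int[mu]_(y in [set y | (N y < N x)%R]) g y).
  move=> mg g0.
  pose f (z : T * T) := (\1_[set w : T * T | (N w.2 < N w.1)%R] z : R)%:E * g z.2.
  have mf : measurable_fun [set: T * T] f.
    apply: emeasurable_funM; last exact: (measurableT_comp mg measurable_snd).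
    by apply/measurable_EFinP; exact: measurable_sublevel2.
  have f0 z : 0 <= f z by rewrite mule_ge0// lee_fin.
  rewrite [X in measurable_fun _ X](_ : _ = fubini_F mu f).
    exact: (measurable_fun_fubini_tonelli_F (m2 := mu) f mf f0).
  apply/funext => x; rewrite integral_mkcond; apply: eq_integral => y _.
  rewrite /f /patch indicE/=; case: ifPn => [/set_mem|/negP] h'.
    by rewrite mem_set// mul1e.
  by rewrite memNset ?mul0e// => h''; apply: h'; rewrite inE.
rewrite [X in measurable_fun _ X](_ : _ = fun x =>
    \int[mu]_(y in [set y | (N y < N x)%R]) h^\+ y -
    \int[mu]_(y in [set y | (N y < N x)%R]) h^\- y).
  apply: emeasurable_funB; apply: key => //.
  - exact: measurable_funepos.
  - exact: measurable_funeneg.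
by apply/funext => x; rewrite integralE.
Qed.

(** The unit ball of the modular is closed under averages. After multiplication by H, Jensen's
    inequality at each x and Tonelli's theorem bound the modular of u by the mean, over h dy / H, of
    the modulars of k(., y). *)
Lemma gauge_minkowski (Psi : T -> R -> R) (h u : T -> \bar R) (k : T * T -> \bar R) :
  (forall x, gauge (Psi x)) ->
  (forall t, (0 <= t)%R -> measurable_fun [set: T] (Psi ^~ t)) ->
  measurable_fun [set: T] h -> (forall y, 0 <= h y) ->
  measurable_fun [set: T] u -> (forall x, 0 <= u x) ->
  measurable_fun [set: T * T] k -> (forall z, 0 <= k z) ->
  0 < \int[mu]_y h y -> \int[mu]_y h y < +oo ->
  {ae mu, forall x, u x * \int[mu]_y h y <= \int[mu]_y (k (x, y) * h y)} ->
  (forall y, \int[mu]_x cext (Psi x) (k (x, y)) <= 1) ->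
  \int[mu]_x cext (Psi x) (u x) <= 1.
Proof.
move=> gP mP mh h0 mu' u0 mk k0 H0 Hoo uk k1.
set H := \int[mu]_y h y in H0 Hoo uk *.
have Hfin : H \is a fin_num by rewrite ge0_fin_numE// ltW.
have mcu : measurable_fun [set: T] (fun x => cext (Psi x) (u x)).
  exact: measurable_cext.
have cu0 x : 0 <= cext (Psi x) (u x) by exact: gauge_cext_ge0.
have mck : measurable_fun [set: T * T] (fun z => cext (Psi z.1) (k z)).
  apply: (@measurable_cext _ _ _ (fun z : T * T => Psi z.1)) => // t t0.
  exact: (measurableT_comp (mP t t0) measurable_fst).
have ck0 z : 0 <= cext (Psi z.1) (k z) by exact: gauge_cext_ge0.
pose f (z : T * T) := cext (Psi z.1) (k z) * h z.2.
have mf : measurable_fun [set: T * T] f.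
  by apply: emeasurable_funM => //; exact: (measurableT_comp mh measurable_snd).
have f0 z : 0 <= f z by rewrite mule_ge0.
have mkx x : measurable_fun [set: T] (fun y => k (x, y)).
  by apply: (measurableT_comp mk); exact: measurable_pair1.
have mky y : measurable_fun [set: T] (fun x => cext (Psi x) (k (x, y))).
  exact: (measurableT_comp mck (@measurable_pair2 _ _ _ _ y)).
have mF : measurable_fun [set: T] (fun x => \int[mu]_y f (x, y)).
  exact: (measurable_fun_fubini_tonelli_F (m2 := mu) f mf f0).
suff : (\int[mu]_x cext (Psi x) (u x)) * H <= H.
  by rewrite -[leRHS]mul1e lee_pmul2r// gt_eqF.
rewrite -ge0_integralZr//; last exact: ltW.
apply: (@le_trans _ _ (\int[mu]_x \int[mu]_y f (x, y))).
  apply: ae_ge0_le_integral => //.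
  - by move=> x _; rewrite mule_ge0// ltW.
  - by apply: emeasurable_funM => //; exact: measurable_cst.
  - by move=> x _; apply: integral_ge0 => y _.
  apply: filterS uk => x uk _.
  exact: (jensen_cext (gP x) mh h0 (mkx x)).
rewrite (fubini_tonelli f mf f0) /f /=.
apply: ge0_le_integral => //.
- by move=> y _; apply: integral_ge0 => x _; exact: (f0 (x, y)).
- exact: (measurable_fun_fubini_tonelli_G (m1 := mu) f mf f0).
move=> y _; rewrite ge0_integralZr//; last first.
  by move=> x _; exact: (ck0 (x, y)).
by rewrite -[leRHS]mul1e; apply: lee_wpmul2r.
Qed.

End sublevel_integrals.

(** * Pointwise bounds for the geometric mean *)

Section log_integral.
Context d (T : measurableType d) {R : realType}.
Variables (mu : {measure set T -> \bar R}) (D : set T) (V : R).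
Hypothesis mD : measurable D.
Hypothesis V_gt0 : 0 < V.
Hypothesis muD : mu D = V%:E.
Local Open Scope ereal_scope.

Lemma ae_integral_gt0 (f : T -> \bar R) : measurable_fun D f ->
  (forall y, 0 <= f y) -> {ae mu, forall y, D y -> 0 < f y} ->
  0 < \int[mu]_(y in D) f y.
Proof.
move=> mf f0 fpos; rewrite lt0e integral_ge0// andbT; apply/negP => /eqP f00.
have : \int[mu]_(y in D) `|f y| = 0.
  by rewrite -[RHS]f00; apply: eq_integral => y _; rewrite gee0_abs.
move=> /(ae_eq_integral_abs _ mD mf) f0'.
have : {ae mu, forall y, ~ D y}.
  apply: filterS2 fpos f0' => y fy fy0 Dy.
  by have := fy Dy; rewrite (fy0 Dy) ltxx.
move=> [N [mN N0 DN]].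
have : mu D <= mu N.
  apply: le_measure; rewrite ?inE// => y Dy.
  by apply: DN => /(_ Dy).
by rewrite N0 muD lee_fin leNgt V_gt0.
Qed.

(** This is the finite part of the majorant of ln f. Its integrability is what allows adding it to
    ln(1/v), whose integral may be infinite. *)
Lemma integral_affine2 (K al be : R) (g l : T -> R) :
  (0 <= al)%R -> (0 <= be)%R ->
  measurable_fun D g -> measurable_fun D l ->
  (forall y, 0 <= g y)%R -> (forall y, 0 <= l y)%R ->
  \int[mu]_(y in D) (g y)%:E < +oo -> \int[mu]_(y in D) (l y)%:E < +oo ->
  mu.-integrable D (EFin \o (fun y => K + (al * g y + be * l y))%R) /\
  \int[mu]_(y in D) (K + (al * g y + be * l y))%:E =
    (K * V)%:E + (al%:E * \int[mu]_(y in D) (g y)%:E +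
                  be%:E * \int[mu]_(y in D) (l y)%:E).
Proof.
move=> al0 be0 mg ml g0 l0 gfin lfin.
have ige (c : R) (q : T -> R) : (0 <= c)%R -> measurable_fun D q ->
    (forall y, 0 <= q y)%R -> \int[mu]_(y in D) (q y)%:E < +oo ->
    mu.-integrable D (EFin \o (fun y => c * q y)%R) /\
    \int[mu]_(y in D) (c * q y)%:E = c%:E * \int[mu]_(y in D) (q y)%:E.
  move=> c0 mq q0 qfin.
  have mq' : measurable_fun D (EFin \o q) by exact/measurable_EFinP.
  have E : \int[mu]_(y in D) (c * q y)%:E = c%:E * \int[mu]_(y in D) (q y)%:E.
    rewrite -(ge0_integralZl mu mD mq' (k := c%:E))//.
    by move=> y _; rewrite lee_fin.
  split => //; apply/integrableP; split.
    by apply/measurable_EFinP; apply: measurable_funM.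
  rewrite (eq_integral (fun y => (c * q y)%:E)).
    by rewrite E lte_mul_pinfty// lee_fin.
  by move=> y _; rewrite /= ger0_norm// mulr_ge0.
have [ig Eg] := ige al g al0 mg g0 gfin.
have [il El] := ige be l be0 ml l0 lfin.
have iK : mu.-integrable D (EFin \o (fun=> K)).
  apply/integrableP; split; first exact: measurable_cst.
  rewrite (eq_integral (cst `|K|%:E))//.
  by rewrite integral_cst// muD -EFinM ltry.
have igl := integrableD mD ig il.
split.
  exact: (integrableD mD iK igl).
transitivity (\int[mu]_(y in D) (K%:E + ((al * g y)%:E + (be * l y)%:E))).
  by apply: eq_integral => y _; rewrite -!EFinD.
rewrite (integralD mD iK igl) (integralD mD ig il) Eg El.
by rewrite integral_cst// muD.
Qed.

(** The tangent of ln at A = I / V, the mean over D of m^(s-1) (f v)^p, gives a pointwise bound, so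
    ln f need not be integrable. The hypothesis on ln V - ln m says that ln m averages to at least
    ln V - 1. *)
Lemma integral_lne_le (f v : T -> \bar R) (m : T -> R) (p s : R) :
  (0 < p)%R -> (1 < s)%R ->
  measurable_fun D f -> (forall y, 0 < f y) ->
  measurable_fun D v -> (forall y, 0 < v y) -> {ae mu, forall y, v y < +oo} ->
  measurable_fun D m -> (forall y, 0 <= m y)%R -> {ae mu, forall y, 0 < m y}%R ->
  (forall y, D y -> m y <= V)%R ->
  \int[mu]_(y in D) (Num.max 0 (ln V - ln (m y)))%:E <= V%:E ->
  (\int[mu]_(y in D) (fun y => lne (v y)^-1)^\+ y < +oo \/
   \int[mu]_(y in D) (fun y => lne (v y)^-1)^\- y < +oo) ->
  let I := \int[mu]_(y in D) ((m y `^ (s - 1))%:E * (f y * v y) `^ p) in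
  I < +oo ->
  0 < I /\ \int[mu]_(y in D) lne (f y) <= \int[mu]_(y in D) lne (v y)^-1 +
    (V * (p^-1 * (ln (fine I / V) + (s - 1) * (1 - ln V))))%:E.
Proof.
move=> p0 s1 mf f0 mv v0 vfin mm m0 mpos mV lm dv I Ioo.
pose q y := (m y `^ (s - 1))%:E * (f y * v y) `^ p.
have q0 y : 0 <= q y by rewrite mule_ge0 ?poweR_ge0// lee_fin powR_ge0.
have mq : measurable_fun D q.
  apply: emeasurable_funM.
    by apply/measurable_EFinP; exact: (measurableT_comp (measurable_powR (s - 1)) mm).
  apply: (measurableT_comp (measurable_poweR p)).
  exact: emeasurable_funM.
have I0 : 0 < I.
  apply: ae_integral_gt0 => //.
  apply: filterS mpos => y my _; rewrite mule_gt0// ?lte_fin ?powR_gt0//.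
  by rewrite poweR_gt0// mule_gt0.
split => //.
have Ifin : I \is a fin_num by rewrite ge0_fin_numE// ltW.
have i0 : (0 < fine I)%R by rewrite fine_gt0// I0.
pose A := (fine I / V)%R.
have A0 : (0 < A)%R by rewrite divr_gt0.
pose l y := Num.max 0%R (ln V - ln (m y))%R.
have l0 y : (0 <= l y)%R by rewrite /l le_max lexx.
have ml : measurable_fun D l.
  apply: measurable_maxr; first exact: measurable_cst.
  apply: measurable_funB; first exact: measurable_cst.
  exact: (measurableT_comp (@measurable_ln R) mm).
(* q may be +oo on a null set; g is real-valued and equals q wherever q is finite. *)
pose g y := fine (q y).
have g0 y : (0 <= g y)%R by exact: fine_ge0.
have mg : measurable_fun D g by exact: (measurableT_comp (@fine_measurable _ _ measurableT) mq).
have gq : \int[mu]_(y in D) (g y)%:E <= I.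
  apply: ge0_le_integral => //.
  - by move=> y _; rewrite lee_fin.
  - exact/measurable_EFinP.
  - by move=> y _; rewrite /g -/(q y); case: (q y) (q0 y).
(* K, [al] and [be] are the coefficients of 1, g and l in p^-1 (ln A - 1 + g / A - (s - 1) ln m),
   where ln m = ln V - l on D. *)
pose K := (p^-1 * (ln A - 1 - (s - 1) * ln V))%R.
pose al := (p^-1 / A)%R.
pose be := (p^-1 * (s - 1))%R.
have al0 : (0 <= al)%R by rewrite divr_ge0 ?invr_ge0// ltW.
have be0 : (0 <= be)%R by rewrite mulr_ge0 ?invr_ge0 ?subr_ge0// ltW.
have [ic Ec] := @integral_affine2 K al be g l al0 be0 mg ml g0 l0
  (le_lt_trans gq Ioo) (le_lt_trans lm (ltry _)).
have mlv : measurable_fun D (fun y => lne (v y)^-1).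
  rewrite (_ : (fun _ => _) = fun y => - lne (v y)).
    by apply: measurableT_comp => //; exact: (measurableT_comp (@measurable_lne R) mv).
  by apply/funext => y; rewrite lne_inve.
apply: (@le_trans _ _ (\int[mu]_(y in D)
    (lne (v y)^-1 + (K + (al * g y + be * l y))%:E))).
  apply: ae_le_integral => //.
  - exact: (measurableT_comp (@measurable_lne R) mf).
  - by apply: emeasurable_funD => //; exact: measurable_int ic.
  have qfin : {ae mu, forall y, D y -> q y \is a fin_num}.
    apply: integrable_ae => //; apply/integrableP; split => //.
    by rewrite (eq_integral q)// => y _; rewrite gee0_abs.
  apply: filterS3 vfin mpos qfin => y vy my qy Dy.
  move: (qy Dy) (v0 y) (f0 y) vy.
  have lE : l y = (ln V - ln (m y))%R.
    by rewrite /l max_r// subr_ge0 ler_ln ?posrE// mV.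
  rewrite /g /q lE; case: (v y) => [b| |]//; case: (f y) => [a| |]//.
    pose r := (m y `^ (s - 1) * (a * b) `^ p)%R.
    rewrite (_ : _ * (a%:E * b%:E) `^ p = r%:E)// => _ + + _.
    rewrite !lte_fin => b0 a0.
    rewrite inver gt_eqF// lneV// !lne_EFin// -EFinN -EFinD lee_fin [fine _]/=.
    have r0 : (0 < r)%R by rewrite mulr_gt0// powR_gt0// mulr_gt0.
    have lnr : ln r = ((s - 1) * ln (m y) + p * (ln a + ln b))%R.
      by rewrite lnM ?posrE ?powR_gt0 ?mulr_gt0// !ln_powR lnM ?posrE.
    have h : (ln r - ln A <= r / A - 1)%R.
      rewrite -ln_div ?posrE//; have rA : (0 < r / A)%R by rewrite divr_gt0.
      have -> : (r / A = 1 + (r / A - 1))%R by ring.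
      by rewrite [X in (_ <= X - 1)%R]addrC subrK; apply: le_ln1Dx; lra.
    have pN0 : p != 0%R by rewrite gt_eqF.
    have := ler_wpM2l (_ : 0 <= p^-1)%R h; rewrite invr_ge0 ltW// => /(_ isT).
    rewrite lnr; set ra := (r / A)%R.
    rewrite /K /al /be.
    have -> : (p^-1 / A * r = p^-1 * ra)%R by rewrite /ra; ring.
    have -> : (p^-1 * ((s - 1) * ln (m y) + p * (ln a + ln b) - ln A) =
       ln a + ln b + p^-1 * ((s - 1) * ln (m y) - ln A))%R by field.
    lra.
  (* Here f y = +oo, which would make q y infinite, against [qfin]. *)
  move=> + b0 _ _; rewrite lte_fin in b0; rewrite mulyr gtr0_sg// mul1e poweRyr ?gt_eqF//.
  by rewrite mulry gtr0_sg ?powR_gt0// mul1e.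
rewrite (integralD_semi mD mlv ic dv) leeD2l// Ec.
apply: (@le_trans _ _ ((K * V)%:E + (al%:E * I + be%:E * V%:E))).
  by rewrite leeD2l// leeD// lee_wpmul2l// lee_fin.
rewrite -(fineK Ifin) -!EFinM -!EFinD lee_fin le_eqVlt; apply/orP; left; apply/eqP.
rewrite /K /al /be -/A.
have -> : (p^-1 / A * fine I)%R = (p^-1 * V)%R.
  by rewrite /A invf_div; field; rewrite !gt_eqF.
ring.
Qed.

End log_integral.

Section geomean_bounds.
Context {R : realType} {n : nat}.
Hypothesis n_gt0 : (0 < n)%N.
Local Notation X := (Rn R n).
Local Notation mu := (@lebesgue R n).
Local Notation leb := (@lebesgue_measure R).
Local Open Scope ereal_scope.

Lemma nvol_ae_gt0 : {ae mu, forall y : X, 0 < nvol y}%R.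
Proof.
exists [set y | nvol y <= 0]%R; split.
- exact: measurable_nvol_le.
- exact: lebesgue_nvol_le.
- by move=> y /=; move/negP; rewrite -leNgt.
Qed.

Lemma integral_eball_ln_nvol (r : R) : (0 < r)%R ->
  \int[mu]_(y in eball n r) (Num.max 0 (ln (vol n r) - ln (nvol y)))%:E
    <= (vol n r)%:E.
Proof.
move=> r0; have V0 : (0 < vol n r)%R by exact: vol_gt0.
rewrite (ge0_integral_eball_nvol n_gt0
  (F := fun u => (Num.max 0 (ln (vol n r) - ln u))%:E) r0); last 2 first.
- apply/measurable_EFinP; apply: measurable_maxr; first exact: measurable_cst.
  by apply: measurable_funB; [exact: measurable_cst|exact: measurable_ln].
- by move=> u _; rewrite lee_fin le_max lexx.
apply: le_trans (integral_ln_lower_le V0).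
rewrite le_eqVlt; apply/orP; left; apply/eqP; apply: eq_integral => u.
rewrite inE/= in_itv/= => /andP[u0 uV].
by rewrite max_r// subr_ge0 ler_ln.
Qed.

Lemma averageE (h : X -> \bar R) (x : X) : (0 < enorm x)%R ->
  average h x = (nvol x)^-1%:E * \int[mu]_(y in eball n (enorm x)) h y.
Proof.
move=> x0; rewrite /average volE inver gt_eqF//.
exact: vol_gt0.
Qed.

Lemma geomean_addr (g h : X -> \bar R) (x : X) (c : R) : (0 < enorm x)%R ->
  \int[mu]_(y in eball n (enorm x)) lne (g y) <=
    \int[mu]_(y in eball n (enorm x)) lne (h y) + (nvol x * c)%:E ->
  geomean g x <= geomean h x * (expR c)%:E.
Proof.
move=> x0 gh; have V0 : (0 < nvol x)%R by exact: vol_gt0.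
rewrite -[(expR c)%:E]/(expeR c%:E) -expeRD lee_expeR !averageE//.
apply: (@le_trans _ _ ((nvol x)^-1%:E *
  (\int[mu]_(y in eball n (enorm x)) lne (h y) + (nvol x * c)%:E))).
  by apply: lee_wpmul2l => //; rewrite lee_fin invr_ge0 ltW.
rewrite muleDr//; last by rewrite fin_num_adde_defl.
by rewrite -EFinM mulrA mulVf ?mul1r// gt_eqF.
Qed.

Lemma geomean_addr_eq (g h : X -> \bar R) (x : X) (c : R) : (0 < enorm x)%R ->
  \int[mu]_(y in eball n (enorm x)) lne (g y) =
    \int[mu]_(y in eball n (enorm x)) lne (h y) + (nvol x * c)%:E ->
  geomean g x = geomean h x * (expR c)%:E.
Proof.
move=> x0 gh; have V0 : (0 < nvol x)%R by exact: vol_gt0.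
rewrite -[(expR c)%:E]/(expeR c%:E) -expeRD; congr expeR; rewrite !averageE// gh.
rewrite muleDr//; last by rewrite fin_num_adde_defl.
by rewrite -EFinM mulrA mulVf ?mul1r// gt_eqF.
Qed.

Lemma geomean_poweR_le (f v : X -> \bar R) (p s : R) (x : X) :
  (0 < p)%R -> (1 < s)%R ->
  measurable_fun [set: X] f -> (forall y, 0 < f y) ->
  weight v -> averages_defined (fun y => lne (v y)^-1) ->
  (0 < enorm x)%R ->
  let I := \int[mu]_(y in eball n (enorm x))
    ((nvol y `^ (s - 1))%:E * (f y * v y) `^ p) in
  I < +oo ->
  geomean f x `^ p <= geomean (fun y => (v y)^-1) x `^ p *
    ((expR (s - 1) * nvol x `^ (- s))%:E * I).
Proof.
move=> p0 s1 mf f0 [mv v0 vfin] dv x0 I Ioo.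
have V0 : (0 < nvol x)%R by exact: vol_gt0.
have mB := @measurable_eball R n (enorm x).
have mm : measurable_fun (eball n (enorm x)) (@nvol R n).
  exact: (measurable_funTS (@measurable_nvol R n)).
have [I0 h] := @integral_lne_le _ _ R mu (eball n (enorm x)) (nvol x) mB V0
  (volE (enorm x)) f v (@nvol R n) p s p0 s1 (measurable_funTS mf) f0
  (measurable_funTS mv) v0 vfin mm (@nvol_ge0 R n) nvol_ae_gt0
  (fun y yx => le_vol (ltW yx)) (integral_eball_ln_nvol x0) (dv _ x0) Ioo.
have Ifin : I \is a fin_num by rewrite ge0_fin_numE// ltW.
have i0 : (0 < fine I)%R by rewrite fine_gt0// I0.
have {}h := geomean_addr x0 h.
have G0 : 0 <= geomean (fun y => (v y)^-1) x by exact: expeR_ge0.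
apply: (@le_trans _ _ ((geomean (fun y => (v y)^-1) x *
  (expR (p^-1 * (ln (fine I / nvol x) + (s - 1) * (1 - ln (nvol x)))))%:E) `^ p)).
  apply: gt0_ler_poweR => //; first exact: ltW.
  - by rewrite in_itv/= leey expeR_ge0.
  - by rewrite in_itv/= leey andbT; exact: (mule_ge0 G0 (expeR_ge0 _%:E)).
rewrite poweRM//.
apply: lee_wpmul2l; first exact: poweR_ge0.
rewrite -(fineK Ifin) poweR_EFin -EFinM lee_fin le_eqVlt; apply/orP; left; apply/eqP.
(* The power p cancels p^-1; what remains is (I / m(x)) e^((s-1)(1 - ln m(x))) = e^(s-1) m(x)^(-s)
   I. *)
rewrite -expRM mulrAC mulVf ?gt_eqF// mul1r.
rewrite expRD lnK ?posrE ?divr_gt0// /powR gt_eqF//.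
have -> : (expR ((s - 1) * (1 - ln (nvol x))) =
    expR (s - 1) * expR (- ((s - 1) * ln (nvol x))))%R.
  by rewrite -expRD; congr expR; ring.
have -> : (expR (- s * ln (nvol x)) =
    (nvol x)^-1 * expR (- ((s - 1) * ln (nvol x))))%R.
  rewrite -[X in (X^-1 * _)%R](lnK (x := nvol x)) ?posrE// -expRN -expRD.
  by congr expR; ring.
by ring.
Qed.

End geomean_bounds.

(** * The test function of the lower bound *)

Section test_function.
Context {R : realType} {n : nat}.
Hypothesis n_gt0 : (0 < n)%N.
Local Notation X := (Rn R n).
Local Notation mu := (@lebesgue R n).
Local Notation leb := (@lebesgue_measure R).
Local Open Scope ereal_scope.

(* The function g of the lower bound is exp (- ln T - s * logtail T m). *)
Definition logtail (T u : R) : R := if (T < u)%R then (1 + (ln u - ln T))%R else 0%R.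

Lemma measurable_logtail T : measurable_fun [set: R] (logtail T).
Proof.
apply: measurable_fun_ifT => //.
- by apply: measurable_fun_ltr; [exact: measurable_cst|exact: measurable_id].
- apply: measurable_funD; first exact: measurable_cst.
  by apply: measurable_funB; [exact: measurable_ln|exact: measurable_cst].
Qed.

Lemma logtail_ge0 T u : (0 < T)%R -> (0 <= logtail T u)%R.
Proof.
move=> T0; rewrite /logtail; case: ifPn => // Tu.
by rewrite addr_ge0// subr_ge0 ltW// ltr_ln ?posrE// (lt_trans T0).
Qed.

Lemma integral_logtail (T c : R) : (0 < T)%R -> (T <= c)%R ->
  \int[leb]_(u in `]0%R, c]) (logtail T u)%:E = (c * (ln c - ln T))%:E.
Proof.
move=> T0 Tc; rewrite -integral_ln_upper//.
rewrite [LHS](_ : _ = \int[leb]_(u in `]0%R, c])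
  ((fun u => (1 + (ln u - ln T))%:E) \_ `]T, c]) u).
  rewrite -integral_mkcondr; congr (integral _ _ _).
  apply/seteqP; split=> u/=; rewrite !in_itv/=; first by case.
  by move=> /andP[Tu ->]; rewrite Tu (lt_trans T0 Tu).
apply: eq_integral => u; rewrite inE/= in_itv/= => /andP[u0 uc].
rewrite /logtail patchE; case: ifPn => [Tu|Tu].
  by rewrite mem_set//= in_itv/= Tu.
by rewrite memNset//= in_itv/= (negbTE Tu).
Qed.

Lemma integral_eball_logtail (r : R) (T : R) : (0 < r)%R -> (0 < T)%R ->
  (T <= vol n r)%R ->
  \int[mu]_(y in eball n r) (logtail T (nvol y))%:E =
  (vol n r * (ln (vol n r) - ln T))%:E.
Proof.
move=> r0 T0 Tr; rewrite -integral_logtail//.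
apply: (ge0_integral_eball_nvol n_gt0 (F := fun u => (logtail T u)%:E) r0).
- by apply/measurable_EFinP; exact: measurable_logtail.
- by move=> u _; rewrite lee_fin logtail_ge0.
Qed.

Lemma integral_exp_logtail_le (T s : R) : (0 < T)%R -> (1 < s)%R ->
  \int[mu]_y (expR (- ln T - s * logtail T (nvol y)))%:E <=
  (1 + expR (- s) / (s - 1))%:E.
Proof.
move=> T0 s1.
pose F u : \bar R := (expR (- ln T - s * logtail T u))%:E.
have mF : measurable_fun [set: R] F.
  apply/measurable_EFinP; apply: (measurableT_comp (@measurable_expR R)).
  apply: measurable_funB; first exact: measurable_cst.
  by apply: measurable_funM; [exact: measurable_cst|exact: measurable_logtail].
have F0 u : 0 <= F u by rewrite lee_fin expR_ge0.
have mFn : measurable_fun [set: X] (F \o @nvol R n).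
  exact: (measurableT_comp mF (@measurable_nvol R n)).
have mN := measurable_nvol_le (n := n) (0 : R)%R.
have N0 : mu [set y | nvol y <= 0]%R = 0 by exact: lebesgue_nvol_le.
rewrite -[leLHS]/(\int[mu]_y (F \o @nvol R n) y).
rewrite (ge0_negligible_integral mN measurableT mFn (fun y _ => F0 (nvol y)) N0).
rewrite [X in integral _ X](_ : _ = @nvol R n @^-1` `]0%R, +oo[%classic); last first.
  apply/seteqP; split=> y/=; rewrite in_itv/= andbT.
    by move=> [_ /negP]; rewrite -ltNge.
  by move=> y0; split=> //; apply/negP; rewrite -ltNge.
rewrite [leLHS](ge0_integral_nvol n_gt0 (F := F)); last 4 first.
- exact: measurable_itv.
- by [].
- exact: measurable_funTS.
- by [].
(* The part up to T contributes 1, the tail at most e^(-s) T^(s-1) T^(1-s) / (s - 1). *)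
rewrite [X in integral _ X](_ : _ = (`]0%R, T]%classic `|` `]T, +oo[%classic)); last first.
  apply/seteqP; split=> u/=; rewrite !in_itv/= !andbT.
    by move=> ->/=; case: (leP u T) => ?; [left|right].
  by case=> [/andP[]//|]; exact: lt_trans.
rewrite ge0_integral_setU//=; last 2 first.
- exact: measurable_funTS.
- rewrite disj_set2E; apply/eqP/seteqP; split=> // u/= []; rewrite !in_itv/= andbT.
  by move=> /andP[_]; rewrite leNgt => /negbTE ->.
rewrite EFinD; apply: leeD.
  rewrite (eq_integral (cst (T^-1)%:E)); last first.
    move=> u; rewrite inE/= in_itv/= => /andP[_]; rewrite leNgt /F /logtail => /negbTE ->.
    by rewrite mulr0 subr0 expRN lnK.
  have lebT : leb (`]0%R, T]%classic : set R) = T%:E.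
    by rewrite lebesgue_measure_itv/= lte_fin T0 -EFinB subr0.
  apply: (@le_trans _ _ ((T^-1)%:E * T%:E)).
    by rewrite -lebT integral_cst.
  by rewrite -EFinM mulVf// gt_eqF.
have c0 : (0 <= expR (- s) * T `^ (s - 1))%R by rewrite mulr_ge0 ?expR_ge0 ?powR_ge0.
apply: (@le_trans _ _ ((expR (- s) * T `^ (s - 1))%:E *
    (\int[leb]_(u in `]T, +oo[) (u `^ (- s))%:E))).
  rewrite -ge0_integralZl//; last 2 first.
  - by apply/measurable_EFinP; apply: measurable_funTS; exact: measurable_powR.
  - by move=> u _; rewrite lee_fin powR_ge0.
  rewrite le_eqVlt; apply/orP; left; apply/eqP; apply: eq_integral => u.
  rewrite inE/= in_itv/= andbT => Tu; have u0 := lt_trans T0 Tu.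
  rewrite /F /logtail Tu -EFinM; congr EFin.
  rewrite /powR !gt_eqF// -!expRD; congr expR; ring.
apply: (@le_trans _ _ ((expR (- s) * T `^ (s - 1))%:E * (T `^ (1 - s) / (s - 1))%:E)).
  by apply: lee_wpmul2l; [rewrite lee_fin|exact: integral_powRN_le].
rewrite -EFinM lee_fin le_eqVlt; apply/orP; left; apply/eqP.
rewrite mulrA -[X in (X / _)%R]mulrA -powRD; last by rewrite (gt_eqF T0) implybT.
by rewrite (_ : (s - 1 + (1 - s))%R = 0%R) ?powRr0 ?mulr1//; ring.
Qed.

End test_function.

Lemma measurable_lne_sub d (T : measurableType d) {R : realType} (D : set T)
    (v : T -> \bar R) (b : T -> R) :
  measurable_fun D v -> (forall y, 0 < v y)%E -> measurable_fun D b ->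
  measurable_fun D (fun y => lne (v y)^-1 + (- b y)%:E)%E.
Proof.
move=> mv v0 mb; apply: emeasurable_funD; last first.
  by apply/measurable_EFinP; exact: (measurableT_comp (@oppr_measurable R _) mb).
rewrite (_ : (fun _ => _) = fun y => - lne (v y))%E.
  exact: (measurableT_comp (@oppe_measurable R _) (measurableT_comp (@measurable_lne R) mv)).
by apply/funext => y; rewrite lne_inve.
Qed.

Section extremal_function.
Context {R : realType} {n : nat}.
Hypothesis n_gt0 : (0 < n)%N.
Local Notation X := (Rn R n).
Local Notation mu := (@lebesgue R n).
Variables (v : X -> \bar R) (p s t : R).
Hypothesis wv : weight v.
Hypothesis dv : averages_defined (fun y => lne (v y)^-1)%E.
Hypothesis p_gt0 : 0 < p.
Hypothesis s_gt1 : 1 < s.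
Hypothesis t_gt0 : 0 < t.
Local Open Scope ereal_scope.

Let T := vol n t.
Let T_gt0 : (0 < T)%R. Proof. exact: vol_gt0. Qed.
Let al : R := (s / p)%R.
Let K : R := (p^-1 * ln T)%R.
(* - nb = ln (g^(1/p)); the term 0 * 0 is there to match [integral_affine2]. *)
Let nb (y : X) : R := (K + (al * logtail T (nvol y) + 0 * 0))%R.

(* g^(1/p) / v for the function g of the lower bound; on the null set where
   v = +oo this quotient would be 0, and it is replaced by 1. *)
Definition extremal (y : X) : \bar R :=
  if v y == +oo then 1 else (expR (- nb y - ln (fine (v y))))%:E.

Let mv : measurable_fun [set: X] v. Proof. by have [] := wv. Qed.
Let v0 y : 0 < v y. Proof. by have [] := wv. Qed.

Let measurable_lt : measurable_fun [set: X] (fun y => logtail T (nvol y)).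
Proof. exact: (measurableT_comp (measurable_logtail T) (@measurable_nvol R n)). Qed.

Let measurable_nb : measurable_fun [set: X] nb.
Proof.
apply: measurable_funD; first exact: measurable_cst.
apply: measurable_funD; last exact: measurable_cst.
by apply: measurable_funM; [exact: measurable_cst|exact: measurable_lt].
Qed.

Lemma measurable_extremal : measurable_fun [set: X] extremal.
Proof.
apply: measurable_fun_ifT.
- apply: (measurable_fun_bool true).
  rewrite (_ : _ @^-1` _ = v @^-1` [set +oo]).
    by apply: mv => //; exact: emeasurable_set1.
  by apply/seteqP; split=> y /= /eqP.
- exact: measurable_cst.
- apply/measurable_EFinP; apply: (measurableT_comp (@measurable_expR R)).
  apply: measurable_funB; first exact: (measurableT_comp (@oppr_measurable R _) measurable_nb).
  apply: (measurableT_comp (@measurable_ln R)).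
  exact: (measurableT_comp (@fine_measurable _ _ measurableT) mv).
Qed.

Lemma extremal_gt0 y : 0 < extremal y.
Proof. by rewrite /extremal; case: ifPn => // _; rewrite lte_fin expR_gt0. Qed.

Lemma lne_extremal : {ae mu, forall y, lne (extremal y) = lne (v y)^-1 + (- nb y)%:E}.
Proof.
have [_ _ vfin] := wv; apply: filterS vfin => y vy.
rewrite lne_inve// /extremal lt_eqF//.
case: (v y) (v0 y) vy => [r| |]//; rewrite lte_fin => r0 _.
rewrite /fine lne_EFin ?expR_gt0// expRK lne_EFin// -EFinN -EFinD.
by congr EFin; rewrite addrC.
Qed.

Let measurable_lnv D : measurable_fun D (fun y => lne (v y)^-1).
Proof.
apply: measurable_funTS.
rewrite (_ : (fun _ => _) = fun y => - lne (v y)).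
  exact: (measurableT_comp (@oppe_measurable R _) (measurableT_comp (@measurable_lne R) mv)).
by apply/funext => y; rewrite lne_inve.
Qed.

Let measurable_lne_extremal D : measurable_fun D (fun y => lne (extremal y)).
Proof.
by apply: measurable_funTS; exact: (measurableT_comp (@measurable_lne R) measurable_extremal).
Qed.

Let integral_logtail_lty r : (0 < r)%R ->
  \int[mu]_(y in eball n r) (logtail T (nvol y))%:E < +oo.
Proof.
move=> r0; have [Tr|/ltW rT] := leP T (vol n r).
  by rewrite (integral_eball_logtail n_gt0 r0 T_gt0 Tr) ltry.
apply: (@le_lt_trans _ _ 0); last exact: ltry.
rewrite le_eqVlt; apply/orP; left; apply/eqP.
apply: integral0_eq => y yr; rewrite /logtail ifF//.
apply/negbTE; rewrite -leNgt; apply: le_trans rT.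
by apply: le_vol; exact: ltW.
Qed.

Let nb_int r (r0 : (0 < r)%R) :=
  @integral_affine2 _ _ R mu (eball n r) (vol n r) (@measurable_eball R n r)
    (volE r) K al 0 (fun y => logtail T (nvol y)) (fun=> 0%R).

Let nb_integral r : (0 < r)%R ->
  mu.-integrable (eball n r) (EFin \o nb) /\
  \int[mu]_(y in eball n r) (nb y)%:E = (K * vol n r)%:E +
    al%:E * \int[mu]_(y in eball n r) (logtail T (nvol y))%:E.
Proof.
move=> r0.
have al0 : (0 <= al)%R by rewrite divr_ge0// ltW// (lt_trans _ s_gt1).
have l0 y : (0 <= logtail T (@nvol R n y))%R by exact: logtail_ge0.
have z : \int[mu]_(y in eball n r) (0%R)%:E < +oo by rewrite integral0 ltry.
have mc : measurable_fun (eball n r) (fun _ : X => 0%R : R) by exact: measurable_cst.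
have [ib E] := nb_int r0 al0 (lexx 0%R) (measurable_funTS measurable_lt)
  mc l0 (fun=> lexx 0%R) (integral_logtail_lty r0) z.
by split; [exact: ib|rewrite [LHS]E mul0e adde0].
Qed.

Let measurable_sum_nb D : measurable_fun D (fun y => lne (v y)^-1 + (- nb y)%:E).
Proof.
exact: (measurable_lne_sub (measurable_funTS mv) v0 (measurable_funTS measurable_nb)).
Qed.

(** The logarithm of [extremal] is a.e. ln(1/v) plus a function integrable on balls, so the
    alternative assumed for v carries over. *)
Lemma averages_defined_extremal : averages_defined (fun y => lne (extremal y)).
Proof.
move=> r r0; have [ib _] := nb_integral r0.
have mB := @measurable_eball R n r.
have iNb : mu.-integrable (eball n r) (EFin \o (fun y => - nb y)%R).
  exact: (integrableN ib).
have ml : measurable_fun (eball n r) (fun y : X => lne (v y)^-1) by exact: measurable_lnv.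
have me : measurable_fun (eball n r) (fun y : X => lne (extremal y)).
  exact: measurable_lne_extremal.
have mab : measurable_fun (eball n r) (fun y => lne (v y)^-1 + (- nb y)%:E).
  exact: measurable_sum_nb.
have [pos|neg] := dv r0; [left|right].
- refine (le_lt_trans _ (funepos_addr_lty mB ml iNb pos)).
  apply: ae_ge0_le_integral; [exact: mB|by []| |by []| |].
  + exact: (measurable_funepos me).
  + exact: (measurable_funepos mab).
  by apply: filterS lne_extremal => y E _; rewrite !funeposE E.
- refine (le_lt_trans _ (funeneg_addr_lty mB ml iNb neg)).
  apply: ae_ge0_le_integral; [exact: mB|by []| |by []| |].
  + exact: (measurable_funeneg me).
  + exact: (measurable_funeneg mab).
  by apply: filterS lne_extremal => y E _; rewrite !funenegE E.
Qed.

(** Equality holds because B(0,|x|) contains B(0,t): over such a ball the average of [logtail] is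
    exactly ln m(x) - ln T. *)
Lemma geomean_extremal x : (t < enorm x)%R ->
  geomean extremal x =
  geomean (fun y => (v y)^-1) x * (T `^ ((s - 1) / p) * nvol x `^ (- (s / p)))%:E.
Proof.
move=> tx; have x0 : (0 < enorm x)%R := lt_trans t_gt0 tx.
have V0 : (0 < nvol x)%R by exact: vol_gt0.
have mB := @measurable_eball R n (enorm x).
have TV : (T <= vol n (enorm x))%R by apply: le_vol; exact: ltW.
have [ib E] := nb_integral x0.
have ml : measurable_fun (eball n (enorm x)) (fun y : X => lne (v y)^-1).
  exact: measurable_lnv.
have iNb : mu.-integrable (eball n (enorm x)) (EFin \o (fun y => - nb y)%R).
  exact: (integrableN ib).
(* L is the average of [nb] over the ball. *)
pose L : R := (K + al * (ln (nvol x) - ln T))%R.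
rewrite (_ : (_ * _)%R = expR (- L)); last first.
  rewrite /powR !gt_eqF// -expRD; congr expR.
  rewrite /L /K /al; field; rewrite gt_eqF//.
apply: geomean_addr_eq => //.
transitivity (\int[mu]_(y in eball n (enorm x)) (lne (v y)^-1 + (- nb y)%:E)).
  apply: ae_eq_integral.
  - exact: mB.
  - exact: measurable_lne_extremal.
  - exact: measurable_sum_nb.
  - by apply: filterS lne_extremal => y Ey _.
rewrite (integralD_semi mB ml iNb (dv x0)); congr (_ + _).
transitivity (- \int[mu]_(y in eball n (enorm x)) (nb y)%:E).
  by rewrite -integralN ?integrable_add_def//; apply: eq_integral => y _; rewrite EFinN.
rewrite E (integral_eball_logtail n_gt0 x0 T_gt0 TV) -EFinM -EFinD -EFinN.
by congr EFin; rewrite /L /nvol; ring.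
Qed.

(** Since p times [nb] is ln T + s [logtail], the p-th power of [extremal] times v is a.e. the
    function g. *)
Lemma Lnorm_extremal_le : weighted_Lnorm p v extremal <=
  ((1 + expR (- s) / (s - 1)) `^ p^-1)%:E.
Proof.
rewrite /weighted_Lnorm unlock -poweR_EFin.
have [_ _ vfin] := wv.
apply: gt0_ler_poweR.
- by rewrite invr_ge0 ltW.
- by rewrite in_itv/= leey andbT integral_ge0// => y _; exact: poweR_ge0.
- rewrite in_itv/= leey andbT lee_fin addr_ge0// divr_ge0 ?expR_ge0//.
  by rewrite subr_ge0 ltW.
apply: le_trans (integral_exp_logtail_le n_gt0 T_gt0 s_gt1).
have mfv : measurable_fun [set: X] (extremal \* v).
  exact: (emeasurable_funM measurable_extremal mv).
apply: ae_ge0_le_integral.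
- exact: measurableT.
- by move=> y _; exact: poweR_ge0.
- have mabs : measurable_fun [set: \bar R] (@abse R) by exact: abse_measurable.
  exact: (measurableT_comp (measurable_poweR p) (measurableT_comp mabs mfv)).
- by move=> y _; rewrite lee_fin expR_ge0.
- apply/measurable_EFinP; apply: (measurableT_comp (@measurable_expR R)).
  apply: measurable_funB; first exact: measurable_cst.
  by apply: measurable_funM; [exact: measurable_cst|exact: measurable_lt].
apply: filterS vfin => y vy _; rewrite /= /extremal lt_eqF//.
case: (v y) (v0 y) vy => [r| |]//; rewrite lte_fin => r0 _.
rewrite /fine -EFinM /abse poweR_EFin lee_fin.
have -> : (expR (- nb y - ln r) * r = expR (- nb y))%R.
  by rewrite -[X in (_ * X)%R](lnK (x := r)) ?posrE// -expRD subrK.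
rewrite ger0_norm ?expR_ge0//.
rewrite -expRM ler_expR le_eqVlt; apply/orP; left; apply/eqP.
by rewrite /nb /K /al; field; rewrite gt_eqF.
Qed.

End extremal_function.

(** * Musielak-Orlicz norms *)

Section musielak.
Context {R : realType} {n : nat}.
Local Notation X := (Rn R n).
Local Notation mu := (@lebesgue R n).
Local Open Scope ereal_scope.

(** The integral of a nonnegative function is a supremum over the simple functions below it, so
    monotonicity holds without measurability and modulars of arbitrary functions can be compared. *)
Lemma ge0_le_integralT d (T : measurableType d) (m : {measure set T -> \bar R})
    (f g : T -> \bar R) :
  (forall x, 0 <= f x) -> (forall x, f x <= g x) ->
  \int[m]_x f x <= \int[m]_x g x.
Proof.
move=> f0 fg; rewrite !ge0_integralTE//; last first.
  by move=> x; exact: le_trans (fg x).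
apply: le_ereal_sup => _ [h hf <-]; exists h => // x.
exact: le_trans (fg x).
Qed.

Variables (p : R) (phi : X -> R -> R).
Hypothesis p_gt0 : (0 < p)%R.
Hypothesis hphi : generalized_phi_function (fun x t => phi x (t `^ p^-1)%R).

Definition psi (x : X) (t : R) : R := phi x (t `^ p^-1)%R.

Lemma gauge_psi x : gauge (psi x).
Proof.
have [h0 hc hz _ _] := hphi.
by split; [move=> t; exact: h0|exact: hc|exact: hz].
Qed.

Lemma measurable_psi t : (0 <= t)%R -> measurable_fun [set: X] (psi ^~ t).
Proof. by move=> t0; have [_ _ _ _ /(_ t t0)] := hphi. Qed.

(** t -> t^p maps [0, +oo[ onto itself, so the two suprema defining the values at +oo agree. *)
Lemma phi_extE x u : 0 <= u -> phi_ext phi x u = cext (psi x) (u `^ p).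
Proof.
have pV (r : R) : (0 <= r)%R -> ((r `^ p) `^ p^-1 = r)%R.
  by move=> r0; rewrite -powRrM mulfV ?powRr1// gt_eqF.
case: u => [r|_|//].
  by rewrite lee_fin => r0 /=; rewrite /psi pV.
rewrite poweRyr ?gt_eqF//=; congr ereal_sup; apply/seteqP; split=> _ [r r0 <-].
  by exists (r `^ p)%R; rewrite /= ?powR_ge0// /psi pV.
by exists (r `^ p^-1)%R => //=; exact: powR_ge0.
Qed.

Lemma phi_ext_ge0 x u : 0 <= u -> 0 <= phi_ext phi x u.
Proof.
move=> u0; rewrite phi_extE//; apply: gauge_cext_ge0; first exact: gauge_psi.
exact: poweR_ge0.
Qed.

Lemma phi_ext_nd x u u' : 0 <= u -> u <= u' -> phi_ext phi x u <= phi_ext phi x u'.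
Proof.
move=> u0 uu'; have u'0 := le_trans u0 uu'; rewrite !phi_extE//.
apply: gauge_cext_nd; [exact: gauge_psi|exact: poweR_ge0|].
by apply: gt0_ler_poweR; rewrite ?in_itv/= ?leey ?u0 ?u'0// ltW.
Qed.

Lemma modularE (F : X -> \bar R) :
  modular phi F = \int[mu]_x cext (psi x) (`|F x| `^ p).
Proof. by apply: eq_integral => x _; rewrite phi_extE. Qed.

Lemma le_modular (F G : X -> \bar R) : (forall x, 0 <= F x) ->
  (forall x, F x <= G x) -> modular phi F <= modular phi G.
Proof.
move=> F0 FG; apply: ge0_le_integralT => x; first exact: phi_ext_ge0.
have G0 := le_trans (F0 x) (FG x).
by apply: phi_ext_nd => //; rewrite !gee0_abs.
Qed.

Lemma musielak_norm_ge0 (F : X -> \bar R) : 0 <= musielak_norm phi F.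
Proof. by apply: le_ereal_inf_tmp => _ [l [l0 _] <-]; rewrite lee_fin ltW. Qed.

(** Strictness provides an admissible l' < l, so the infimum defining the norm need not be attained.
    This is the source of the strict inequalities on [D] below. *)
Lemma modular_le1 (F : X -> \bar R) l : (forall x, 0 <= F x) ->
  musielak_norm phi F < l%:E -> modular phi (fun x => F x * l^-1%:E) <= 1.
Proof.
move=> F0 /ereal_inf_lt[_ [l' [l'0 Fl'] <-]]; rewrite lte_fin => l'l.
apply: le_trans Fl'; apply: le_modular => x.
  by rewrite mule_ge0// lee_fin invr_ge0 ltW// (lt_trans l'0).
apply: lee_wpmul2l => //.
have l0 := lt_trans l'0 l'l.
by rewrite lee_fin lef_pV2 ?posrE //; exact: ltW.
Qed.

Lemma musielak_norm_scale_le (F G : X -> \bar R) (c : R) : (0 < c)%R ->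
  (forall x, 0 <= F x) -> (forall x, c%:E * F x <= G x) ->
  c%:E * musielak_norm phi F <= musielak_norm phi G.
Proof.
move=> c0 F0 FG; apply: le_ereal_inf_tmp => _ [l [l0 Gl] <-].
rewrite -lee_pdivlMl//; apply: ereal_inf_lbound.
exists (c^-1 * l)%R => //; split; first by rewrite mulr_gt0// invr_gt0.
apply: le_trans Gl; apply: le_modular => x.
  by rewrite mule_ge0// lee_fin invr_ge0 ltW// mulr_gt0// invr_gt0.
rewrite invfM invrK EFinM muleA [F x * _]muleC.
by apply: lee_wpmul2r => //; rewrite lee_fin invr_ge0 ltW.
Qed.

End musielak.

Section measurability.
Context {R : realType} {n : nat}.
Local Notation X := (Rn R n).
Local Notation mu := (@lebesgue R n).
Local Open Scope ereal_scope.

Lemma measurable_average (h : X -> \bar R) : measurable_fun [set: X] h ->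
  measurable_fun [set: X] (average h).
Proof.
move=> mh.
have m1 : measurable_fun [set: X] (fun x => \int[mu]_(y in eball n (enorm x)) h y).
  exact: (measurable_integral_sublevel mu (@measurable_enorm R n) mh).
have mv : measurable_fun [set: X] (fun x => (nvol x)%:E).
  by apply/measurable_EFinP; exact: measurable_nvol.
have m2 : measurable_fun [set: X] (fun x => expeR (- lne (nvol x)%:E)).
  exact: (measurableT_comp (@measurable_expeR R)
    (measurableT_comp (@oppe_measurable R _) (measurableT_comp (@measurable_lne R) mv))).
rewrite (_ : average h = fun x =>
    expeR (- lne (nvol x)%:E) * \int[mu]_(y in eball n (enorm x)) h y).
  exact: (emeasurable_funM m2 m1).
by apply/funext => x; rewrite /average volE inve_expeR// lee_fin vol_ge0.
Qed.

Lemma measurable_geomean (f : X -> \bar R) : measurable_fun [set: X] f ->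
  measurable_fun [set: X] (geomean f).
Proof.
move=> mf; have mlf := measurableT_comp (@measurable_lne R) mf.
exact: (measurableT_comp (@measurable_expeR R) (measurable_average mlf)).
Qed.

Lemma geomean_inve (v : X -> \bar R) : (forall x, 0 < v x) ->
  geomean (fun y => (v y)^-1) = geomean (fun y => expeR (- lne (v y))).
Proof.
move=> v0; congr geomean; apply/funext => y.
by rewrite inve_expeR// ltW.
Qed.

Lemma measurable_geomean_inve (v : X -> \bar R) : measurable_fun [set: X] v ->
  (forall x, 0 < v x) -> measurable_fun [set: X] (geomean (fun y => (v y)^-1)).
Proof.
move=> mv v0; rewrite (geomean_inve v0); apply: measurable_geomean.
exact: (measurableT_comp (@measurable_expeR R)
    (measurableT_comp (@oppe_measurable R _) (measurableT_comp (@measurable_lne R) mv))).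
Qed.

End measurability.

(** On the left is the kernel at (x, y), with N = m(x), T = m(y), V = G(1/v)(x), and b telling
    whether |y| < |x|. On the right is the p-th power of the weighted tail of radius |y|, normalised
    by C T^(-(s-1)/p), to which a bound on [D] applies. *)
Lemma hardy_tail_poweR {R : realType} (p s C T N : R) (b : bool) (V w : \bar R) :
  0 < p -> 0 < C -> 0 < T -> (b -> 0 < N) -> (0 <= V)%E -> (0 <= w)%E ->
  ((b%:R * T `^ (s - 1))%:E * ((C `^ (- p) * N `^ (- s))%:E * (V * w) `^ p) =
  `|(b%:R * N `^ (- (s / p)))%:E * V * w *
    (C * T `^ (- ((s - 1) / p)))^-1%:E| `^ p)%E.
Proof.
move=> p0 C0 T0 N0 V0 w0; set l := (_ * _ `^ (- ((s - 1) / p)))%R.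
have l0 : 0 < l by rewrite mulr_gt0// powR_gt0.
case: b N0 => [/(_ isT) N0|_]; last first.
  by rewrite !mul0r !mul0e abse0 poweR0r// gt_eqF.
rewrite !mul1r gee0_abs; last first.
  by rewrite !mule_ge0// lee_fin ?powR_ge0// invr_ge0 ltW.
have -> : ((N `^ (- (s / p)))%:E * V * w * l^-1%:E =
    (N `^ (- (s / p)) * l^-1)%:E * (V * w))%E.
  by rewrite EFinM -!muleA; congr (_ * _)%E; rewrite muleA muleC.
have N_l0 : (0 <= (N `^ (- (s / p)) * l^-1)%:E)%E.
  by rewrite lee_fin mulr_ge0 ?powR_ge0// invr_ge0 ltW.
rewrite (poweRM _ N_l0 (mule_ge0 V0 w0)).
rewrite muleA -(EFinM (T `^ (s - 1))) poweR_EFin; congr (_%:E * _)%E.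
have lnl : ln l = ln C - (s - 1) / p * ln T.
  by rewrite /l lnM ?posrE ?powR_gt0// ln_powR mulNr.
rewrite [RHS]/powR gt_eqF ?divr_gt0 ?powR_gt0//.
rewrite ln_div ?posrE ?powR_gt0// ln_powR lnl.
rewrite /powR !gt_eqF// -!expRD; congr expR.
by field; rewrite gt_eqF.
Qed.

Section weighted_subset_integrals.
Context d (T : measurableType d) {R : realType}.
Variables (mu : {measure set T -> \bar R}) (D : set T).
Hypothesis mD : measurable D.
Local Open Scope ereal_scope.

Lemma integral_gt0_of_subset (h : T -> \bar R) (V : R) : (0 < V)%R -> mu D = V%:E ->
  measurable_fun [set: T] h -> (forall y, 0 < h y) -> 0 < \int[mu]_y h y.
Proof.
move=> V0 DV mh h0; have hge0 y : 0 <= h y by exact: ltW.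
apply: (@lt_le_trans _ _ (\int[mu]_(y in D) h y)).
  apply: (ae_integral_gt0 mD V0 DV) => //; first exact: measurable_funTS.
  by apply: aeW => y _.
exact: ge0_subset_integral.
Qed.

Lemma integral_bounded_mul_le (g : T -> R) (h : T -> \bar R) (M : R) :
  measurable_fun [set: T] g -> (forall y, 0 <= g y)%R -> (0 <= M)%R ->
  (forall y, D y -> g y <= M)%R ->
  measurable_fun [set: T] h -> (forall y, 0 <= h y) ->
  \int[mu]_(y in D) ((g y)%:E * h y) <= M%:E * \int[mu]_y h y.
Proof.
move=> mg g0 M0 gM mh h0.
rewrite -ge0_integralZl//.
have mgh : measurable_fun [set: T] (fun y => (g y)%:E * h y).
  by apply: emeasurable_funM => //; exact/measurable_EFinP.
apply: (@le_trans _ _ (\int[mu]_(y in D) (M%:E * h y))).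
  apply: ge0_le_integral => //.
  - by move=> y _; rewrite mule_ge0// lee_fin.
  - exact: measurable_funTS.
  - by apply: measurable_funTS; exact: measurable_funeM.
  - by move=> y yD; apply: lee_wpmul2r => //; rewrite lee_fin gM.
apply: ge0_subset_integral => //; first exact: measurable_funeM.
by move=> y _; rewrite mule_ge0// lee_fin.
Qed.

Lemma integral_indic_mul (g : T -> R) (h : T -> \bar R) (c : \bar R) :
  measurable_fun [set: T] g -> (forall y, 0 <= g y)%R -> 0 <= c ->
  measurable_fun [set: T] h -> (forall y, 0 <= h y) ->
  \int[mu]_y (((\1_D y : R) * g y)%:E * c * h y) =
  c * \int[mu]_(y in D) ((g y)%:E * h y).
Proof.
move=> mg g0 c0 mh h0.
have mgh : measurable_fun [set: T] (fun y => (g y)%:E * h y).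
  by apply: emeasurable_funM => //; exact/measurable_EFinP.
have gh0 y : 0 <= (g y)%:E * h y by rewrite mule_ge0// lee_fin.
rewrite -ge0_integralZl//; last exact: measurable_funTS.
rewrite [RHS]integral_mkcond; apply: eq_integral => y _; rewrite patchE indicE.
case: (y \in D); last by rewrite mul0r !mul0e.
by rewrite mul1r -muleA muleCA.
Qed.

End weighted_subset_integrals.

(** Here eta is the integral of h. The factor e^(s-1) of the pointwise bound is absorbed by passing
    from C to C e^(-(s-1)/p), which is the bound then required of D(s). *)
Lemma geomean_scaling {R : realType} (p s C N eta : R) (G V w I : \bar R) :
  0 < p -> 0 < C -> 0 < N -> 0 < eta ->
  (0 <= G)%E -> (0 <= V)%E -> (0 <= w)%E ->
  (G `^ p <= V `^ p * ((expR (s - 1) * N `^ (- s))%:E * I))%E ->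
  (`|G * w * (C * eta `^ p^-1)^-1%:E| `^ p * eta%:E <=
  ((C * expR (- ((s - 1) / p))) `^ (- p) * N `^ (- s))%:E * (V * w) `^ p * I)%E.
Proof.
move=> p0 C0 N0 eta0 G0 V0 w0 GV.
have l0 : 0 < C * eta `^ p^-1 by rewrite mulr_gt0// powR_gt0.
have lV0 : (0 <= (C * eta `^ p^-1)^-1%:E)%E by rewrite lee_fin invr_ge0 ltW.
rewrite gee0_abs; last by rewrite !mule_ge0.
rewrite (poweRM _ (mule_ge0 G0 w0) lV0) (poweRM _ G0 w0) (poweRM _ V0 w0) poweR_EFin.
have E1 : (C * eta `^ p^-1)^-1 `^ p * eta = C `^ (- p).
  rewrite [_^-1 `^ p]/powR gt_eqF ?invr_gt0//.
  rewrite lnV ?posrE// lnM ?posrE ?powR_gt0// ln_powR.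
  rewrite -[X in _ * X](lnK (x := eta)) ?posrE// -expRD /powR gt_eqF//.
  by congr expR; field; rewrite gt_eqF.
have E2 : (C * expR (- ((s - 1) / p))) `^ (- p) = C `^ (- p) * expR (s - 1).
  rewrite [LHS]/powR gt_eqF ?mulr_gt0 ?expR_gt0//.
  rewrite lnM ?posrE ?expR_gt0// expRK /powR gt_eqF// -expRD.
  by congr expR; field; rewrite gt_eqF.
rewrite -muleA -EFinM E1 E2.
apply: (@le_trans _ _ (V `^ p * ((expR (s - 1) * N `^ (- s))%:E * I) * w `^ p
    * (C `^ (- p))%:E)%E).
  apply: lee_wpmul2r; first by rewrite lee_fin powR_ge0.
  by apply: lee_wpmul2r; first exact: poweR_ge0.
rewrite -(mulrA _ (expR _)) (EFinM (C `^ (- p))).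
rewrite le_eqVlt; apply/orP; left; apply/eqP.
rewrite [LHS]muleC -!muleA; congr (_ * _)%E.
rewrite [LHS]muleCA; congr (_ * _)%E; congr (_ * _)%E.
by rewrite muleC.
Qed.

(** * The two estimates between D(s) and the constant *)

Section characterization.
Context {R : realType} {n : nat}.
Hypothesis n_gt0 : (0 < n)%N.
Local Notation X := (Rn R n).
Local Notation mu := (@lebesgue R n).
Variables (p : R) (phi : X -> R -> R) (v w : X -> \bar R).
Hypothesis p_gt0 : 0 < p.
Hypothesis hphi : generalized_phi_function (fun x t => phi x (t `^ p^-1)).
Hypothesis wv : weight v.
Hypothesis ww : weight w.
Hypothesis dv : averages_defined (fun y => lne (v y)^-1)%E.
Local Open Scope ereal_scope.

Let V (x : X) := geomean (fun y => (v y)^-1) x.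
Let V_ge0 x : 0 <= V x. Proof. exact: expeR_ge0. Qed.
Let v0 y : 0 < v y. Proof. by have [] := wv. Qed.
Let w0 y : 0 < w y. Proof. by have [] := ww. Qed.
Let w_ge0 y : 0 <= w y. Proof. exact: ltW. Qed.

(* The function whose norm enters [D] at the radius t. *)
Definition hardy_tail (s t : R) (x : X) : \bar R :=
  (\1_[set z : X | (t < enorm z)%R] x)%:E / mu (eball n (enorm x)) `^ (s / p)%R * V x.

Lemma hardy_tailE s t x : (0 <= t)%R -> hardy_tail s t x =
  ((\1_[set z : X | (t < enorm z)%R] x : R) * nvol x `^ (- (s / p)))%:E * V x.
Proof.
move=> t0; rewrite /hardy_tail indicE; congr (_ * _).
have [|tx] := boolP (x \in _); last by rewrite /= mul0e mul0r.
rewrite inE/= => tx; have x0 := le_lt_trans t0 tx.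
have X0 : (0 < nvol x)%R by exact: vol_gt0.
by rewrite volE poweR_EFin inver gt_eqF ?powR_gt0// -EFinM powRN.
Qed.

Lemma hardy_tail_ge0 s t x : (0 <= t)%R -> 0 <= hardy_tail s t x.
Proof.
by move=> t0; rewrite hardy_tailE// mule_ge0// lee_fin mulr_ge0// powR_ge0.
Qed.

Lemma D_ge0 s : 0 <= D phi p v w s.
Proof.
apply: (@le_trans _ _ (mu (eball n 1) `^ ((s - 1) / p)%R *
    weighted_musielak_norm phi w (hardy_tail s 1))).
  by rewrite mule_ge0 ?poweR_ge0// musielak_norm_ge0.
by apply: ereal_sup_ubound; exists 1%R => //=.
Qed.

(** Wherever the tail of radius t is nonzero, the geometric mean of [extremal] is T^((s-1)/p) times
    that tail, so the test gives the term of [D] at t. *)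
Lemma D_le_of_inequality s C : (1 < s)%R -> (0 < C)%R ->
  geomean_inequality phi p v w C ->
  D phi p v w s <= (C * (1 + expR (- s) / (s - 1)) `^ p^-1)%:E.
Proof.
move=> s1 C0 hC; apply: ge_ereal_sup => _ [t t0 <-].
have T0 : (0 < vol n t)%R by exact: vol_gt0.
pose f := extremal v p s t.
have h := hC f (measurable_extremal p s t wv) (extremal_gt0 v p s t)
  (averages_defined_extremal n_gt0 wv dv p_gt0 s1 t0).
have c0 : (0 < vol n t `^ ((s - 1) / p))%R by exact: powR_gt0.
rewrite volE poweR_EFin.
apply: (@le_trans _ _ (weighted_musielak_norm phi w (geomean f))).
  apply: (musielak_norm_scale_le p_gt0 hphi (F := fun x => hardy_tail s t x * w x) c0).
    by move=> x; rewrite mule_ge0// hardy_tail_ge0// ltW.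
  move=> x; rewrite muleA; apply: lee_wpmul2r => //.
  rewrite (hardy_tailE _ _ (ltW t0)) indicE; case: (boolP (x \in _)) => [|_]; last first.
    by rewrite mul0r mul0e mule0 expeR_ge0.
  rewrite inE/= => tx; rewrite mul1r muleA -EFinM muleC.
  by rewrite (geomean_extremal n_gt0 wv dv p_gt0 s1 t0 tx).
apply: (le_trans h); rewrite EFinM; apply: lee_wpmul2l.
  by rewrite lee_fin ltW.
exact: (Lnorm_extremal_le n_gt0 wv p_gt0 s1 t0).
Qed.

(** z.1 is the point x at which Gf is taken, z.2 the integration variable y. *)
Let kernel (s c : R) (z : X * X) : \bar R :=
  ((\1_[set q : X * X | (enorm q.2 < enorm q.1)%R] z : R) * nvol z.2 `^ (s - 1))%:E *
  ((c * nvol z.1 `^ (- s))%:E * (V z.1 * w z.1) `^ p).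

Let kernel_ge0 s c z : (0 <= c)%R -> 0 <= kernel s c z.
Proof.
move=> c0; apply: mule_ge0; first by rewrite lee_fin mulr_ge0 ?powR_ge0.
by rewrite mule_ge0 ?poweR_ge0// lee_fin mulr_ge0 ?powR_ge0.
Qed.

Let measurable_kernel s c : measurable_fun [set: X * X] (kernel s c).
Proof.
have [mv _ _] := wv; have [mw _ _] := ww.
have mN (q : R) : measurable_fun [set: X] (fun x => nvol x `^ q)%R.
  exact: (measurableT_comp (measurable_powR q) (@measurable_nvol R n)).
have mVw : measurable_fun [set: X] (fun x => V x * w x).
  exact: (emeasurable_funM (measurable_geomean_inve mv v0) mw).
have m1 : measurable_fun [set: X * X] (fun z : X * X =>
    ((\1_[set q : X * X | (enorm q.2 < enorm q.1)%R] z : R) * nvol z.2 `^ (s - 1))%:E).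
  apply/measurable_EFinP.
  exact: (measurable_funM (measurable_sublevel2 (@measurable_enorm R n))
    (measurableT_comp (mN (s - 1)%R) measurable_snd)).
have mc : measurable_fun [set: X] (fun _ : X => c) by exact: measurable_cst.
have m2 : measurable_fun [set: X] (fun x => (c * nvol x `^ (- s))%:E).
  by apply/measurable_EFinP; exact: (measurable_funM mc (mN (- s)%R)).
have m3 : measurable_fun [set: X] (fun x => (c * nvol x `^ (- s))%:E * (V x * w x) `^ p).
  exact: (emeasurable_funM m2 (measurableT_comp (measurable_poweR p) mVw)).
exact: (emeasurable_funM m1 (measurableT_comp m3 measurable_fst)).
Qed.

Let kernel_modular s (C : R) y : (1 < s)%R -> (0 < C)%R ->
  D phi p v w s < C%:E ->
  \int[mu]_x cext (psi p phi x) (kernel s (C `^ (- p)) (x, y)) <= 1.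
Proof.
move=> s1 C0 DC.
have := enorm_ge0 y; rewrite le_eqVlt => /predU1P[y0|t0].
  (* The radius 0 does not occur in [D], but here m(y) = 0 and m(y)^(s-1) = 0 because s > 1, so the
     kernel vanishes. *)
  rewrite integral0_eq// => x _; rewrite /kernel /= /nvol -y0.
  rewrite {1}/vol eball_le0// measure0 /= powR0 ?subr_eq0 ?gt_eqF// mulr0 mul0e.
  by have [_ _ /= ->] := gauge_psi hphi x.
set t := enorm y in t0.
have T0 : (0 < vol n t)%R by exact: vol_gt0.
(* The bound on the norm of the tail that D(s) < C yields at the radius t. *)
pose l := (C * vol n t `^ (- ((s - 1) / p)))%R.
have l0 : (0 < l)%R by rewrite mulr_gt0// powR_gt0.
have tail0 x : 0 <= hardy_tail s t x * w x by rewrite mule_ge0// hardy_tail_ge0// ltW.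
have Nl : musielak_norm phi (fun x => hardy_tail s t x * w x) < l%:E.
  have : mu (eball n t) `^ ((s - 1) / p)%R * weighted_musielak_norm phi w (hardy_tail s t) < C%:E.
    by apply: le_lt_trans DC; apply: ereal_sup_ubound; exists t.
  rewrite volE poweR_EFin -lte_pdivlMl ?powR_gt0//.
  by rewrite /l powRN EFinM muleC.
have := modular_le1 p_gt0 hphi tail0 Nl.
rewrite (modularE _ p_gt0); apply: le_trans; rewrite le_eqVlt; apply/orP; left; apply/eqP.
apply: eq_integral => x _; congr cext.
rewrite (hardy_tailE _ _ (ltW t0)) /kernel/= -/t !indicE.
have -> : ((x, y) \in [set q : X * X | (enorm q.2 < enorm q.1)%R]) = (t < enorm x)%R.
  by apply/idP/idP; rewrite inE.
have -> : (x \in [set z : X | (t < enorm z)%R]) = (t < enorm x)%R.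
  by apply/idP/idP; rewrite inE.
apply: hardy_tail_poweR => //.
by move=> tx; apply: vol_gt0; exact: lt_trans tx.
Qed.

Lemma inequality_of_D s C : (1 < s)%R -> (0 < C)%R ->
  (expR ((s - 1) / p))%:E * D phi p v w s < C%:E ->
  geomean_inequality phi p v w C.
Proof.
move=> s1 C0 DC f mf f0 df.
have [mv _ vfin] := wv; have [mw _ _] := ww.
pose h y := (f y * v y) `^ p.
have fv0 y : 0 < f y * v y by exact: mule_gt0.
have h0 y : 0 <= h y by exact: poweR_ge0.
have mfv : measurable_fun [set: X] (fun y => f y * v y).
  exact: (emeasurable_funM mf mv).
have mh : measurable_fun [set: X] h.
  exact: (measurableT_comp (measurable_poweR p) mfv).
set H := \int[mu]_y h y.
have LE : weighted_Lnorm p v f = H `^ p^-1.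
  rewrite /weighted_Lnorm unlock; congr (_ `^ _); apply: eq_integral => y _.
  by rewrite gee0_abs// ltW.
rewrite LE.
have H0 : 0 < H.
  apply: (integral_gt0_of_subset (@measurable_eball R n 1) (vol_gt0 ltr01) (volE 1) mh).
  by move=> y; exact: poweR_gt0.
have [Hoo|Hoo] := eqVneq H +oo.
  by rewrite Hoo poweRyr ?gt0_muley ?leey ?lte_fin// gt_eqF// invr_gt0.
have {}Hoo : H < +oo by rewrite ltey.
have Hfin : H \is a fin_num by rewrite ge0_fin_numE// ltW.
pose eta := fine H.
have eta0 : (0 < eta)%R by rewrite fine_gt0// H0.
pose C' := (C * expR (- ((s - 1) / p)))%R.
have C'0 : (0 < C')%R by rewrite mulr_gt0// expR_gt0.
have DC' : D phi p v w s < C'%:E.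
  by rewrite /C' mulrC EFinM expRN lte_pdivlMl// expR_gt0.
pose l := (C * eta `^ p^-1)%R.
have l0 : (0 < l)%R by rewrite mulr_gt0// powR_gt0.
rewrite -(fineK Hfin) -/eta poweR_EFin -EFinM -/l.
apply: ereal_inf_lbound; exists l => //; split=> //.
rewrite (modularE _ p_gt0).
have mG := measurable_geomean mf.
have mGw : measurable_fun [set: X] (fun x => geomean f x * w x * l^-1%:E).
  apply: emeasurable_funM; last exact: measurable_cst.
  exact: (emeasurable_funM mG mw).
have mabs : measurable_fun [set: \bar R] (@abse R) by exact: abse_measurable.
have mu' : measurable_fun [set: X] (fun x => `|geomean f x * w x * l^-1%:E| `^ p).
  exact: (measurableT_comp (measurable_poweR p) (measurableT_comp mabs mGw)).
have c'0 : (0 <= C' `^ (- p))%R by exact: powR_ge0.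
apply: (gauge_minkowski (mu := mu) (gauge_psi hphi) (@measurable_psi _ _ _ _ hphi) mh h0
  mu' (fun x => poweR_ge0 _ _) (@measurable_kernel s (C' `^ (- p)))
  (fun z => @kernel_ge0 s _ z c'0) H0 Hoo); last first.
  by move=> y; exact: kernel_modular.
(* Only the origin is excluded, where the ball is empty. *)
apply: filterS (nvol_ae_gt0 n_gt0) => x X0.
have x0 : (0 < enorm x)%R.
  rewrite ltNge; apply/negP => x0.
  by move: X0; rewrite /nvol /vol eball_le0// measure0 ltxx.
rewrite -/H.
set I := \int[mu]_(y in eball n (enorm x)) ((nvol y `^ (s - 1))%:E * h y).
have mg : measurable_fun [set: X] (fun y => nvol y `^ (s - 1))%R.
  exact: (measurableT_comp (measurable_powR (s - 1)) (@measurable_nvol R n)).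
have g0 (y : X) : (0 <= nvol y `^ (s - 1))%R by exact: powR_ge0.
have mB := @measurable_eball R n (enorm x).
have gM y : eball n (enorm x) y -> (nvol y `^ (s - 1) <= nvol x `^ (s - 1))%R.
  move=> yx; apply: ge0_ler_powR.
  - by rewrite subr_ge0 ltW.
  - by rewrite nnegrE nvol_ge0.
  - by rewrite nnegrE nvol_ge0.
  - by apply: le_vol; exact: ltW.
have Ioo : I < +oo.
  apply: le_lt_trans (integral_bounded_mul_le mu mB mg g0 (g0 x) gM mh h0) _.
  by rewrite lte_mul_pinfty// lee_fin.
have Gle := geomean_poweR_le n_gt0 p_gt0 s1 mf f0 wv dv x0 Ioo.
have c0 : 0 <= (C' `^ (- p) * nvol x `^ (- s))%:E * (V x * w x) `^ p.
  by rewrite mule_ge0 ?poweR_ge0// lee_fin mulr_ge0// powR_ge0.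
have -> : \int[mu]_y (kernel s (C' `^ (- p)) (x, y) * h y) =
    (C' `^ (- p) * nvol x `^ (- s))%:E * (V x * w x) `^ p * I.
  rewrite -[RHS](integral_indic_mul mu mB mg g0 c0 mh h0).
  apply: eq_integral => y _; rewrite /kernel/= !indicE.
  by congr (((_ : bool)%:R * _)%:E * _ * _); apply/idP/idP; rewrite !inE.
rewrite -[H](fineK Hfin) -/eta.
exact: (geomean_scaling p_gt0 C0 X0 eta0 (expeR_ge0 _) (V_ge0 x) (w_ge0 x) Gle).
Qed.

End characterization.

Theorem theorem4 (R : realType) (n : nat) (hn : (0 < n)%N) (p : R) (hp : 0 < p)
    (phi : Rn R n -> R -> R)
    (hphi : generalized_phi_function (fun x t => phi x (t `^ p^-1)))
    (v w : Rn R n -> \bar R) (hv : weight v) (hw : weight w)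
    (hlnv : averages_defined (fun y => lne (v y)^-1)) :
  (forall s : R, 1 < s ->
     (exists C : R, 0 < C /\ geomean_inequality phi p v w C) <->
     (D phi p v w s < +oo)%E) /\
  (ereal_sup
     [set (expR (s / p) / (expR s + (s - 1)^-1) `^ p^-1)%:E * D phi p v w s
     | s in [set s : R | (1 < s)%R]] <= best_constant phi p v w)%E /\
  (best_constant phi p v w <=
     (2 `^ p^-1)%:E *
     ereal_inf [set (expR ((s - 1) / p))%:E * D phi p v w s
               | s in [set s : R | (1 < s)%R]])%E.
Proof.
have eD_ge0 s : (0 <= (expR ((s - 1) / p))%:E * D phi p v w s)%E.
  by rewrite mule_ge0 ?D_ge0// lee_fin expR_ge0.
have upper s C : 1 < s -> 0 < C -> ((expR ((s - 1) / p))%:E * D phi p v w s < C%:E)%E ->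
    geomean_inequality phi p v w C.
  by move=> s1 C0; exact: (inequality_of_D hn hp hphi hv hw hlnv).
have lower s C : 1 < s -> 0 < C -> geomean_inequality phi p v w C ->
    (D phi p v w s <= (C * (1 + expR (- s) / (s - 1)) `^ p^-1)%:E)%E.
  by move=> s1 C0; exact: (D_le_of_inequality hn hp hphi hv hw hlnv).
split; [|split].
- move=> s s1; split => [[C [C0 hC]]|Doo].
    exact: le_lt_trans (lower _ _ s1 C0 hC) (ltry _).
  have Dfin : ((expR ((s - 1) / p))%:E * D phi p v w s)%E \is a fin_num.
    by rewrite ge0_fin_numE// lte_mul_pinfty// lee_fin expR_ge0.
  (* Adding 1 makes the constant positive and the inequality strict, as [upper] requires. *)
  exists (fine ((expR ((s - 1) / p))%:E * D phi p v w s)%E + 1); split.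
    by rewrite ltr_wpDl// fine_ge0.
  apply: (upper s) => //; first by rewrite ltr_wpDl// fine_ge0.
  by rewrite EFinD fineK// lteDl// lte01.
- apply: ge_ereal_sup => _ [s s1 <-]; apply: le_ereal_inf_tmp => _ [C [C0 hC] <-].
  have s10 : 0 < s - 1 by rewrite subr_gt0.
  have M0 : 0 < 1 + expR (- s) / (s - 1) by rewrite addr_gt0// divr_gt0// expR_gt0.
  have k0 : 0 <= expR (s / p) / (expR s + (s - 1)^-1) `^ p^-1.
    by rewrite divr_ge0 ?expR_ge0 ?powR_ge0.
  apply: le_trans (lee_wpmul2l _ (lower _ _ s1 C0 hC)) _; first by rewrite lee_fin.
  (* With this factorisation e^(s/p) cancels, and the claim for s is [lower] divided by its
     constant. *)
  have E : expR s + (s - 1)^-1 = expR s * (1 + expR (- s) / (s - 1)).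
    by rewrite mulrDr mulr1 mulrA -expRD subrr expR0 mul1r.
  have Ep : expR s `^ p^-1 = expR (s / p) by rewrite -expRM.
  rewrite E powRM ?expR_ge0 ?(ltW M0)// Ep -EFinM lee_fin le_eqVlt.
  apply/orP; left; apply/eqP; field.
  by rewrite !gt_eqF ?expR_gt0 ?powR_gt0.
have best_le s : 1 < s ->
    (best_constant phi p v w <= (expR ((s - 1) / p))%:E * D phi p v w s)%E.
  move=> s1; set B := (leRHS).
  have [->|Boo] := eqVneq B +oo%E; first exact: leey.
  have Bfin : B \is a fin_num by rewrite ge0_fin_numE ?eD_ge0// ltey.
  (* The slack e supplies the strict inequality and a positive constant even when B = 0. *)
  apply/lee_addgt0Pr => e e0; apply: ereal_inf_lbound.
  exists (fine B + e); last by rewrite EFinD fineK.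
  have Be : 0 < fine B + e by rewrite ltr_wpDl// fine_ge0// eD_ge0.
  by split=> //; apply: (upper s) => //; rewrite EFinD fineK// lteDl// lte_fin.
set J := ereal_inf _.
have J0 : (0 <= J)%E by apply: le_ereal_inf_tmp => _ [s _ <-].
(* J already bounds the best constant, and 1 <= 2^(1/p). *)
apply: (@le_trans _ _ J).
  by apply: le_ereal_inf_tmp => _ [s s1 <-]; exact: best_le.
rewrite -[leLHS]mul1e; apply: lee_wpmul2r => //.
rewrite lee_fin -[leLHS](powRr0 2); apply: ler_powR; first by rewrite ler1n.
by rewrite invr_ge0 ltW.
Qed.
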